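(* There exist universal constants $C,c>0$ such that the following holds. Let $1\le n\le N$ be integers, let $1\le r\le 2$, and let $A$ be an $n\times N$ matrix whose entries are independent centered random variables with variance one whose $\psi_r$ norms are bounded by some constant $\psi$. Then, for any $N\le\exp(cn^{r/2}/\psi^{2r})$, with probability at least $1-C\exp(-cn^{r/2}/\psi^{2r})$, the polytopes $K^+(A)$ and $K(A)$ are $m$-neighborly and $m$-centrally-neighborly, respectively, whenever $1\le m\le n$ satisfies $$ m\le\frac{cn}{\psi^4\log^{2/r}(C\psi^6N/n)}. $$
   Context: For a real random variable $Y$ and $r>0$, $\|Y\|_{\psi_r}=\inf\{C>0:\ \mathbb{E}\exp((|Y|/C)^r)\le 2\}$. For an $n\times N$ matrix $A$ with columns $X_1,\dots,X_N\in\mathbb{R}^n$, $K^+(A)$ is the convex hull of $X_1,\dots,X_N$ and $K(A)$ is the convex hull of $\pm X_1,\dots,\pm X_N$. A polytope is $m$-neighborly if any set of less than $m$ of its vertices is the vertex set of a face. A centrally symmetric convex polytope is $m$-centrally-neighborly if any set of less than $m$ of its vertices containing no opposite pair (no $v$ together with $-v$) is the vertex set of a face. *)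

(* Defs.v *)
From HB Require Import structures.
From mathcomp Require Import all_boot all_order all_algebra finmap.
From mathcomp Require Import all_classical all_reals all_analysis.
Set Implicit Arguments.
Unset Strict Implicit.
Unset Printing Implicit Defensive.
Import Order.TTheory GRing.Theory Num.Theory.
Import numFieldNormedType.Exports.
Local Open Scope classical_set_scope.
Local Open Scope ring_scope.

Section RandomVariables.
Context {d : measure_display} {T : measurableType d} {R : realType}.
Variable P : probability T R.

(* Extended-real valued, with value +oo when the set is empty. *)
Definition psi_norm (r : R) (Y : T -> R) : \bar R :=
  ereal_inf [set C%:E | C in [set C : R | 0 < C /\
    ('E_P[fun t => expR ((`|Y t| / C) `^ r)] <= 2%:E)%E]].

Definition mutually_independent (I : finType) (X : I -> {RV P >-> R}) : Prop :=
  forall (J : {set I}) (B : I -> set R),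
    (forall i, measurable (B i)) ->
    P (\bigcap_(i in [set` J]) (X i @^-1` B i)) =
    (\prod_(i in J) P (X i @^-1` B i))%E.

(* The event {t | Q t} need not be known to be measurable: the bound is on
   some measurable event contained in it. *)
Definition with_probability_at_least (p : R) (Q : T -> Prop) : Prop :=
  exists E : set T, [/\ measurable E, E `<=` [set t | Q t] & (p%:E <= P E)%E].

End RandomVariables.

Section Polytopes.
Context {R : realType} {n : nat}.
Implicit Types (K F : set 'cV[R]_n) (u v x : 'cV[R]_n).

Definition dotmul u x : R := \sum_(i < n) u i 0 * x i 0.

Definition convex_hull (S : set 'cV[R]_n) : set 'cV[R]_n :=
  smallest (@convex_set R 'cV[R]_n) S.

(* Taking u = 0 shows that the empty set and K itself count as faces. *)
Definition is_face K F : Prop :=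
  exists (u : 'cV[R]_n) (b : R),
    (forall x, K x -> dotmul u x <= b) /\
    F = [set x | K x /\ dotmul u x = b].

Definition vertices K : set 'cV[R]_n := [set v | is_face K [set v]].

Definition is_vertex_set_of_face K (V : set 'cV[R]_n) : Prop :=
  exists F, is_face K F /\ vertices F = V.

Definition neighborly (m : nat) K : Prop :=
  forall V : {fset 'cV[R]_n},
    [set` V] `<=` vertices K -> (#|` V| < m)%N ->
    is_vertex_set_of_face K [set` V].

Definition centrally_symmetric K : Prop := forall x, K x -> K (- x).

Definition centrally_neighborly (m : nat) K : Prop :=
  centrally_symmetric K /\
  forall V : {fset 'cV[R]_n},
    [set` V] `<=` vertices K -> (#|` V| < m)%N ->
    (forall v, v \in V -> - v \notin V) ->
    is_vertex_set_of_face K [set` V].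

Definition Kplus (N : nat) (A : 'M[R]_(n, N)) : set 'cV[R]_n :=
  convex_hull [set x | exists j, x = col j A].

Definition Kpm (N : nat) (A : 'M[R]_(n, N)) : set 'cV[R]_n :=
  convex_hull [set x | exists j, x = col j A \/ x = - col j A].

End Polytopes.

(* Main.v *)
Require Import Defs.
From HB Require Import structures.
From mathcomp Require Import all_boot all_order all_algebra finmap.
From mathcomp Require Import all_classical all_reals all_analysis.
From mathcomp Require Import measurable_realfun.
From mathcomp Require Import ring lra.
Import Order.TTheory GRing.Theory Num.Theory.
Import numFieldNormedType.Exports.
Local Open Scope classical_set_scope.
Local Open Scope ring_scope.
Set Implicit Arguments.
Unset Strict Implicit.

(** Let X_1, ..., X_N be the columns of A. Points eps_i X_i, for i in a set I of
    fewer than m indices, are the vertices of a face of K(A) if some vector u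
    satisfies <u, X_i> = eps_i on I and |<u, X_j>| < 1 off I; for K^+(A) take
    eps = 1. By duality such a u exists when every h in the kernel of A has at
    most a third of its l1 norm on I: this is [null_space_property], and the
    duality is [dual_certificate].

    The null space property follows from two facts ([kernel_l2_le_l1]): the
    columns satisfy |X_j|^2 <= 3 n, and |A y|^2 >= (n/2) |y|^2 for every integer
    vector y that is a sum of s = 54 m signed basis vectors. Indeed h / |h|_1 is
    the mean of a random signed basis vector, and by Maurey's empirical method
    ([derandomized_maurey]) the quadratic form |A x|^2 - (n/2) |x|^2 is, at some
    sum of s signed basis vectors, at most the mean value of this random sum.
    For A h = 0 this gives (s - 1) |h|_2^2 <= 6 |h|_1^2, so that h cannot be
    concentrated on fewer than m coordinates.

    Both facts hold with large probability. Put D = n / psi^4 and H = D^(r/2).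
    For a fixed y the numbers (A y)_i are independent, with mean square |y|^2
    and fourth moment O(psi^4 |y|^4), hence |A y|^2 < (n/2) |y|^2 has
    probability at most exp (- c D) ([lattice_vector_lower_tail]). With
    L = log (C psi^6 N / n) the number of vectors y is at most
    exp (s L + 4 N exp (- L)) ([card_compositions_le]); the restriction on m
    says that s L is a small multiple of D, so a union bound over the lattice
    vectors succeeds. For the columns, with high probability no entry exceeds
    sqrt n, and for lambda = H / (2^14 n) the variable lambda min (a^2, n) is
    dominated by a multiple of (|a| / psi)^r, which has an exponential moment;
    the Chernoff bound then gives a failure probability
    exp (- lambda n) = exp (- H / 2^14) for each of the N <= exp (c H) columns
    ([truncated_mgf], [truncated_column_bound]). *)

(** * Duality between kernel and row space *)

(** Finite-dimensional Hahn-Banach: the functional h |-> sum over D of z h on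
    the subspace L is dominated by the seminorm b * (l1 norm off D), and is
    pushed to one more coordinate at a time, until nothing is left to dominate
    it and it vanishes on L. *)
Lemma extend_dominated_functional (R : realType) (N : nat)
    (L : 'cV[R]_N -> Prop) (b : R) (D : {set 'I_N}) (z : 'I_N -> R) :
  0 <= b ->
  (forall x y, L x -> L y -> L (x + y)) ->
  (forall a x, L x -> L (a *: x)) ->
  (forall h, L h ->
     \sum_(j in D) z j * h j 0 <= b * \sum_(j | j \notin D) `|h j 0|) ->
  exists z' : 'I_N -> R,
    [/\ {in D, z' =1 z}, forall j, j \notin D -> `|z' j| <= b &
        forall h, L h -> \sum_j z' j * h j 0 = 0].
Proof.
move=> b0 LD LZ.
have [k] := ubnP #|~: D|; elim: k D z => // k IH D z /ltnSE leDk zle.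
have [DT|[i iD]] := set_0Vmem (~: D).
  have DE j : j \in D.
    by apply/negPn/negP => jD; have := finset.in_set0 j; rewrite -DT finset.in_setC jD.
  exists z; split=> [//|j|h Lh]; first by rewrite DE.
  have E (g : 'I_N -> R) : \sum_(j in D) g j = \sum_j g j.
    by apply: eq_bigl => j; rewrite DE.
  have E0 (g : 'I_N -> R) : \sum_(j | j \notin D) g j = 0.
    by rewrite big_pred0// => j; rewrite DE.
  have := zle _ Lh; have := zle _ (LZ (-1) _ Lh).
  rewrite !E !E0 mulr0 => h1 h2; apply/eqP; rewrite eq_le h2/=.
  have : \sum_j z j * (-1 *: h) j 0 = - \sum_j z j * h j 0.
    by rewrite -sumrN; apply: eq_bigr => j _; rewrite !mxE; ring.
  by lra.
move: iD; rewrite inE => iD.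
pose Z (h : 'cV[R]_N) := \sum_(j in D) z j * h j 0.
pose W (h : 'cV[R]_N) := b * \sum_(j | j \notin i |: D) `|h j 0|.
have Wsplit (h : 'cV[R]_N) : b * \sum_(j | j \notin D) `|h j 0| = W h + b * `|h i 0|.
  rewrite (bigD1 i)//= mulrDr addrC; congr (b * _ + _).
  by apply: eq_bigl => j; rewrite !inE negb_or andbC.
have Zle h : L h -> Z h <= W h + b * `|h i 0|.
  by move=> Lh; rewrite -Wsplit; exact: zle.
have ZD h h' : Z (h + h') = Z h + Z h'.
  by rewrite /Z -big_split/=; apply: eq_bigr => j _; rewrite !mxE mulrDr.
have ZZ a h : Z (a *: h) = a * Z h.
  by rewrite /Z mulr_sumr; apply: eq_bigr => j _; rewrite !mxE mulrCA.
have WD h h' : W (h + h') <= W h + W h'.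
  rewrite /W -mulrDr ler_wpM2l// -big_split/=; apply: ler_sum => j _.
  by rewrite !mxE ler_normD.
have WZ a h : W (a *: h) = `|a| * W h.
  rewrite /W mulrCA; congr (b * _); rewrite mulr_sumr.
  by apply: eq_bigr => j _; rewrite !mxE normrM.
(* The admissible values at i are squeezed between the numbers
   Z h - W h with h i = -1 and the numbers W h - Z h with h i = 1. *)
pose S := [set x : R | x = - b \/
  exists h, [/\ L h, h i 0 = -1 & x = Z h - W h]].
have SNb : S (- b) by left.
have Sub x : S x -> x <= b.
  case=> [->|[h [Lh hi ->]]]; first by lra.
  by have := Zle _ Lh; rewrite hi normrN1; lra.
pose t := sup S.
have hS : has_sup S by split; [exists (- b)|exists b => x /Sub].
have tge x : S x -> x <= t by move=> Sx; apply: sup_upper_bound.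
have tle y : (forall x, S x -> x <= y) -> t <= y.
  by move=> Hy; apply: ge_sup; [exists (- b)|move=> x /Hy].
have tb : `|t| <= b by rewrite ler_norml tge//= tle.
have tpos h : L h -> h i 0 = 1 -> t <= W h - Z h.
  move=> Lh hi; apply: tle => x [->|[h' [Lh' hi' ->]]].
    by have := Zle _ Lh; rewrite hi normr1; lra.
  have := Zle _ (LD _ _ Lh Lh'); rewrite ZD mxE hi hi' subrr normr0 mulr0 addr0.
  by have := WD h h'; lra.
have tneg h : L h -> h i 0 = -1 -> Z h - W h <= t.
  by move=> Lh hi; apply: tge; right; exists h.
have tall h : L h -> Z h + t * h i 0 <= W h.
  move=> Lh; have [h0|h0|h0] := ltgtP (h i 0) 0.
  - have a0 : 0 < - (h i 0)^-1 by rewrite oppr_gt0 invr_lt0.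
    have := tneg _ (LZ (- (h i 0)^-1) _ Lh).
    rewrite mxE mulNr mulVf ?lt_eqF// => /(_ erefl).
    rewrite ZZ WZ (gtr0_norm a0) => H.
    have := @ler_wpM2l _ (- h i 0) _ _ _ H; rewrite oppr_ge0 ltW// => /(_ isT).
    have nz : h i 0 != 0 by rewrite lt_eqF.
    have -> : - h i 0 * (- (h i 0)^-1 * Z h - - (h i 0)^-1 * W h) = Z h - W h.
      by field.
    by lra.
  - have a0 : 0 < (h i 0)^-1 by rewrite invr_gt0.
    have nz : h i 0 != 0 by rewrite gt_eqF.
    have := tpos _ (LZ (h i 0)^-1 _ Lh).
    rewrite mxE mulVf// => /(_ erefl).
    rewrite ZZ WZ (gtr0_norm a0) => H.
    have := @ler_wpM2l _ (h i 0) _ _ _ H; rewrite ltW// => /(_ isT).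
    have -> : h i 0 * ((h i 0)^-1 * W h - (h i 0)^-1 * Z h) = W h - Z h.
      by field.
    by lra.
  - by have := Zle _ Lh; rewrite h0 normr0 !mulr0 !addr0.
have [||z' [zD zb z0]] := IH (i |: D) (fun j => if j == i then t else z j).
- apply: leq_trans leDk; apply: proper_card; apply/properP; split.
    by rewrite finset.setCS finset.subsetUr.
  by exists i; rewrite !inE ?eqxx.
- move=> h Lh; rewrite big_setU1//= eqxx addrC.
  rewrite (eq_bigr (fun j => z j * h j 0)) ?tall// => j jD.
  by case: eqVneq => // ji; rewrite -ji jD in iD.
exists z'; split=> // j jD.
  by rewrite zD ?inE ?jD ?orbT//; case: eqVneq => // ji; rewrite -ji jD in iD.
have [->|ji] := eqVneq j i; first by rewrite zD ?inE ?eqxx.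
by apply: zb; rewrite !inE (negPf ji).
Qed.

Lemma orthogonal_to_kernel (R : realType) (n N : nat) (A : 'M[R]_(n, N))
    (z : 'I_N -> R) :
  (forall h : 'cV[R]_N, A *m h = 0 -> \sum_j z j * h j 0 = 0) ->
  exists u : 'cV[R]_n, forall j, dotmul u (col j A) = z j.
Proof.
move=> zK; pose v : 'rV[R]_N := \row_j z j.
have : (v <= A)%MS.
  rewrite submxE; apply/eqP/rowP => k; rewrite !mxE.
  rewrite -[RHS](zK (col k (cokermx A))).
    by apply: eq_bigr => j _; rewrite !mxE.
  by rewrite colE mulmxA mulmx_coker mul0mx.
move=> /submxP[w vE]; exists w^T => j.
have := congr1 (fun M : 'rV[R]_N => M 0 j) vE; rewrite !mxE => ->.
by apply: eq_bigr => i _; rewrite !mxE.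
Qed.

(** The constant 1/2, rather than 1, leaves a margin: it makes the
    coordinates of the dual certificate off I strictly smaller than 1. *)
Definition null_space_property (R : realType) (n N m : nat) (A : 'M[R]_(n, N)) :=
  forall (h : 'cV[R]_N) (I : {set 'I_N}), A *m h = 0 -> (#|I| < m)%N ->
    \sum_(i in I) `|h i 0| <= 2^-1 * \sum_(j | j \notin I) `|h j 0|.

(** On the kernel of A, the functional h |-> sum over I of eps h is dominated
    by half the l1 norm off I. Extending it to a functional that vanishes on
    the kernel yields a vector orthogonal to the kernel, i.e. A^T u, equal to
    eps on I and bounded by 1/2 elsewhere. *)
Lemma dual_certificate (R : realType) (n N m : nat) (A : 'M[R]_(n, N))
    (I : {set 'I_N}) (eps : 'I_N -> R) :
  null_space_property m A -> (#|I| < m)%N -> (forall i, `|eps i| <= 1) ->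
  exists u : 'cV[R]_n,
    {in I, forall i, dotmul u (col i A) = eps i} /\
    forall j, j \notin I -> `|dotmul u (col j A)| < 1.
Proof.
move=> nspA Im eps1.
have [||||z [zI zb z0]] :=
  @extend_dominated_functional R N (fun h => A *m h = 0) 2^-1 I eps.
- by lra.
- by move=> x y Ax Ay; rewrite mulmxDr Ax Ay addr0.
- by move=> a x Ax; rewrite -scalemxAr Ax scaler0.
- move=> h Ah; apply: le_trans (nspA _ _ Ah Im); apply: ler_sum => i _.
  apply: le_trans (ler_norm _) _; rewrite normrM ler_piMl//.
have [u uz] := orthogonal_to_kernel z0.
exists u; split=> [i iI|j jI]; rewrite uz; first exact: zI.
by apply: le_lt_trans (zb _ jI) _; lra.
Qed.

(** * Faces of the convex hull of finitely many points *)

Section Hull.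
Variables (R : realType) (n : nat).
Implicit Types (K F : set 'cV[R]_n) (u v x : 'cV[R]_n).

Lemma dotmulZr u a x : dotmul u (a *: x) = a * dotmul u x.
Proof.
by rewrite /dotmul mulr_sumr; apply: eq_bigr => i _; rewrite mxE mulrCA.
Qed.

Lemma dotmulNr u x : dotmul u (- x) = - dotmul u x.
Proof. by rewrite -scaleN1r dotmulZr mulN1r. Qed.

Lemma dotmul_sumr u (L : finType) (w : L -> R) (g : L -> 'cV[R]_n) :
  dotmul u (\sum_l w l *: g l) = \sum_l w l * dotmul u (g l).
Proof.
rewrite /dotmul; under eq_bigr do rewrite summxE mulr_sumr.
rewrite exchange_big; apply: eq_bigr => l _; rewrite mulr_sumr.
by apply: eq_bigr => i _; rewrite mxE mulrCA.
Qed.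

Lemma sub_convex_hull (S : set 'cV[R]_n) : S `<=` convex_hull S.
Proof. exact: sub_smallest. Qed.

Lemma convex_hull_min (S K : set 'cV[R]_n) :
  convex_set (K : set (convex_lmodType 'cV[R]_n)) -> S `<=` K ->
  convex_hull S `<=` K.
Proof. by move=> cK SK; apply: smallest_sub. Qed.

Lemma convex_hull_convex (S : set 'cV[R]_n) :
  convex_set (convex_hull S : set (convex_lmodType 'cV[R]_n)).
Proof.
move=> x y t; rewrite !inE => Sx Sy K SK.
have := SK.1 x y t; rewrite !inE; apply; [exact: Sx|exact: Sy].
Qed.

Lemma convex_combination_of_hull (L : finType) (g : L -> 'cV[R]_n) x :
  convex_hull (range g) x ->
  exists w : L -> R,
    [/\ forall l, 0 <= w l, \sum_l w l = 1 & x = \sum_l w l *: g l].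
Proof.
move: x; apply: convex_hull_min.
  move=> x y t; rewrite !inE => -[w [w0 w1 ->]] [w' [w'0 w'1 ->]].
  have t0 : 0 <= t%:num by [].
  have t1 : 0 <= 1 - t%:num by rewrite subr_ge0.
  exists (fun l => t%:num * w l + (1 - t%:num) * w' l); split.
  - by move=> l; rewrite addr_ge0 ?mulr_ge0.
  - by rewrite big_split/= -!mulr_sumr w1 w'1 !mulr1 addrC subrK.
  - transitivity (t%:num *: (\sum_l w l *: g l)
                  + (1 - t%:num) *: (\sum_l w' l *: g l)); first by [].
    under [RHS]eq_bigr do rewrite scalerDl -!scalerA.
    by rewrite [RHS]big_split/= -!scaler_sumr.
move=> _ [l _ <-]; exists (fun k => (k == l)%:R); split.
- by move=> k; rewrite ler0n.
- by rewrite (bigD1 l)//= eqxx big1 ?addr0// => k /negPf ->.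
- by rewrite (bigD1 l)//= eqxx scale1r big1 ?addr0// => k /negPf ->; rewrite scale0r.
Qed.

Lemma weight_gt0 (L : finType) (w : L -> R) :
  (forall l, 0 <= w l) -> \sum_l w l = 1 -> exists l, 0 < w l.
Proof.
move=> w0 w1; apply: contrapT => /forallNP nw.
suff : \sum_l w l = 0 by rewrite w1 => /eqP; rewrite oner_eq0.
by apply: big1 => l _; apply/eqP; rewrite eq_le w0 andbT leNgt; apply/negP.
Qed.

(** The nonnegative gaps b - a l have weighted mean zero. *)
Lemma tight_generator (L : finType) (w a : L -> R) (b : R) :
  (forall l, 0 <= w l) -> \sum_l w l = 1 ->
  (forall l, 0 < w l -> a l <= b) -> \sum_l w l * a l = b ->
  forall l, 0 < w l -> a l = b.
Proof.
move=> w0 w1 ab wab l wl.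
have wD k : w k * a k <= w k * b.
  have := w0 k; rewrite le_eqVlt => /predU1P[<-|wk]; first by rewrite !mul0r.
  by rewrite ler_pM2l// ab.
have : \sum_k (w k * b - w k * a k) = 0.
  by rewrite sumrB -mulr_suml w1 wab mul1r subrr.
move=> /eqP; rewrite psumr_eq0; last by move=> k _; rewrite subr_ge0.
move=> /allP /(_ l); rewrite mem_index_enum => /(_ isT) /=.
rewrite -mulrBr mulf_eq0 gt_eqF//= subr_eq0 => /eqP ->//.
Qed.

(** A vertex of the face cut out by u is a convex combination of generators;
    those of positive weight lie in the face, and then at the vertex. In the
    other direction a vertex of K that lies in the face is a vertex of the face,
    exposed there by the same functional; this is where V `<=` vertices K is
    used. *)
Lemma vertex_set_of_exposed_generators (L : finType) (g : L -> 'cV[R]_n) u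
    (K := convex_hull (range g))
    (V := [set v | exists2 l, v = g l & dotmul u (g l) = 1]) :
  (forall l, dotmul u (g l) <= 1) -> V `<=` vertices K ->
  is_vertex_set_of_face K V.
Proof.
move=> ug VK; pose F := [set x | K x /\ dotmul u x = 1].
have Kg l : K (g l) by apply: sub_convex_hull; exists l.
have uK x : K x -> dotmul u x <= 1.
  move=> /convex_combination_of_hull[w [w0 w1 ->]]; rewrite dotmul_sumr.
  apply: le_trans (_ : \sum_l w l * 1 <= _).
    by apply: ler_sum => l _; rewrite ler_wpM2l.
  by rewrite -mulr_suml w1 mulr1.
exists F; split; first by exists u, 1.
apply/seteqP; split=> x.
- move=> [u' [b' [u'F xE]]].
  have [[Kx ux] u'x] : F x /\ dotmul u' x = b'.
    by have : [set x] x by []; rewrite xE.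
  have [w [w0 w1 xw]] := convex_combination_of_hull Kx.
  have Fw l : 0 < w l -> F (g l).
    move=> wl; split=> //.
    apply: (@tight_generator _ w (fun k => dotmul u (g k)) 1) wl => //.
    by rewrite -dotmul_sumr -xw.
  have [l wl] := weight_gt0 w0 w1.
  have Vl := Fw _ wl.
  have u'l : dotmul u' (g l) = b'.
    apply: (@tight_generator _ w (fun k => dotmul u' (g k)) b') wl => // [k /Fw/u'F//|].
    by rewrite -dotmul_sumr -xw.
  have : [set y | F y /\ dotmul u' y = b'] (g l) by split.
  by rewrite -xE => /= <-; exists l => //; case: Vl.
- move=> Vx; have [l xl ul] := Vx.
  have [u' [b' [u'K xE]]] := VK _ Vx.
  have Fx : F x by rewrite xl; split.
  exists u', b'; split=> [y [Ky _]|]; first exact: u'K.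
  apply/seteqP; split=> y.
    by move=> ->; split=> //; have : [set x] x by []; rewrite xE => -[].
  by move=> [[Ky _] u'y]; rewrite xE; split.
Qed.

Lemma vertex_is_generator (L : finType) (g : L -> 'cV[R]_n) v :
  vertices (convex_hull (range g)) v -> exists l, v = g l.
Proof.
move=> [u [b [uK vE]]].
have [Kv uv] : convex_hull (range g) v /\ dotmul u v = b.
  by have : [set v] v by []; rewrite vE.
have [w [w0 w1 vw]] := convex_combination_of_hull Kv.
have [l wl] := weight_gt0 w0 w1.
have Kg k : convex_hull (range g) (g k) by apply: sub_convex_hull; exists k.
have ul : dotmul u (g l) = b.
  apply: (@tight_generator _ w (fun k => dotmul u (g k)) b) wl => // [k _|].
    exact: uK.
  by rewrite -dotmul_sumr -vw.
exists l; have : [set y | convex_hull (range g) y /\ dotmul u y = b] (g l) by split.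
by rewrite -vE.
Qed.

End Hull.

(** * Neighborliness from the null space property *)

Section Neighborliness.
Variables (R : realType) (n N m : nat) (A : 'M[R]_(n, N)).
Hypothesis nspA : null_space_property m A.

(** The set I picks one column index for each point of V, so that #|I| <= #|V|
    even if columns are repeated; the dual certificate with all signs equal to
    1 then exposes exactly V. *)
Lemma null_space_property_neighborly : neighborly m (Kplus A).
Proof.
have KE : Kplus A = convex_hull (range (fun j => col j A)).
  congr convex_hull; apply/seteqP; split=> x; first by move=> [j ->]; exists j.
  by move=> [j _ <-]; exists j.
rewrite KE => V VK Vm.
have /choice[J JE] : forall v : V, exists j, val v = col j A.
  by move=> v; apply: vertex_is_generator; apply: VK; exact: valP.
have Im : (#|[set J v | v : V]| < m)%N.
  by apply: leq_ltn_trans (leq_imset_card _ _) _; rewrite -cardfE.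
have [|u [uI uJ]] := dual_certificate (eps := fun=> 1) nspA Im.
  by move=> _; rewrite normr1.
have uV (v : V) : dotmul u (val v) = 1.
  by rewrite JE uI//; apply: imset_f.
have VE : [set` V] = [set v | exists2 j, v = col j A & dotmul u (col j A) = 1].
  apply/seteqP; split=> v.
    move=> vV; exists (J [` vV]%fset); first exact: (JE [` vV]%fset).
    by rewrite -JE uV.
  move=> [j -> uj].
  have [/imsetP[w _ ->]|/uJ] := boolP (j \in [set J v | v : V]).
    by rewrite -JE; exact: valP.
  by rewrite uj normr1 ltxx.
rewrite VE; apply: vertex_set_of_exposed_generators; last by rewrite -VE.
move=> j; have [/imsetP[w _ ->]|/uJ] := boolP (j \in [set J v | v : V]).
  by rewrite -JE uV.
by move=> /ltW; apply: le_trans; exact: ler_norm.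
Qed.

Lemma Kpm_centrally_symmetric : centrally_symmetric (Kpm A).
Proof.
apply: (@convex_hull_min _ _ _ (fun x => Kpm A (- x))).
  move=> x y t; rewrite !inE => Kx Ky.
  have -> : - conv t x y = conv t (- x : convex_lmodType 'cV[R]_n) (- y).
    by rewrite /conv/= opprD -!scalerN.
  by apply/set_mem; apply: convex_hull_convex; apply/mem_set.
move=> _ [j [->|->]]; apply: sub_convex_hull; exists j; [by right|left].
by rewrite opprK.
Qed.

(** The signs of the certificate are read off V, and are consistent because V
    contains no opposite pair. *)
Lemma null_space_property_centrally_neighborly : centrally_neighborly m (Kpm A).
Proof.
pose g (l : 'I_N * bool) := if l.2 then col l.1 A else - col l.1 A.
have KE : Kpm A = convex_hull (range g).
  congr convex_hull; apply/seteqP; split=> x.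
    by move=> [j [->|->]]; [exists (j, true)|exists (j, false)].
  by move=> [[j []] _ <-]; exists j; [left|right].
split; first exact: Kpm_centrally_symmetric.
rewrite KE => V VK Vm Vopp.
have /choice[J JE] : forall v : V, exists l, val v = g l.
  by move=> v; apply: vertex_is_generator; apply: VK; exact: valP.
have Im : (#|[set (J v).1 | v : V]| < m)%N.
  by apply: leq_ltn_trans (leq_imset_card _ _) _; rewrite -cardfE.
pose eps i : R := if [exists v : V, J v == (i, true)] then 1 else -1.
have [|u [uI uJ]] := dual_certificate (eps := eps) nspA Im.
  by move=> i; rewrite /eps; case: ifP => _; rewrite ?normrN1 ?normr1.
have uV (v : V) : dotmul u (val v) = 1.
  have vI : (J v).1 \in [set (J v).1 | v : V] by apply: imset_f.
  have := JE v; have := uI _ vI.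
  rewrite /g /eps; case E: (J v) => [i []]/=.
    by rewrite ifT => [ui ->//|]; apply/existsP; exists v; rewrite E.
  rewrite ifF => [ui ->|]; first by rewrite dotmulNr ui opprK.
  apply/negbTE/negP => /existsP[v' /eqP E'].
  have := Vopp _ (valP v); rewrite [val v]JE E /g/= opprK.
  by have := valP v'; rewrite [val v']JE E' /g/= => ->.
have gV l : dotmul u (g l) = 1 -> g l \in V.
  move=> ul; have [/imsetP[w _ lw]|/uJ] := boolP (l.1 \in [set (J v).1 | v : V]).
    suff -> : g l = val w by exact: valP.
    have := uV w; move: ul; rewrite JE /g lw.
    by case: ifP => _; case: ifP => _ // a b; exfalso; move: a b;
      rewrite dotmulNr; lra.
  rewrite ltr_norml => /andP[u1 u2]; exfalso; move: ul u1 u2.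
  by rewrite /g; case: ifP => _; rewrite ?dotmulNr; lra.
have VE : [set` V] = [set v | exists2 l, v = g l & dotmul u (g l) = 1].
  apply/seteqP; split=> v; last by move=> [l -> /gV].
  move=> vV; exists (J [` vV]%fset); first exact: (JE [` vV]%fset).
  by rewrite -JE uV.
rewrite VE; apply: vertex_set_of_exposed_generators; last by rewrite -VE.
move=> l; have [/imsetP[w _ lw]|/uJ] := boolP (l.1 \in [set (J v).1 | v : V]).
  have := uV w; rewrite JE /g lw.
  by case: ifP => _; case: ifP => _; rewrite ?dotmulNr => E; rewrite ?E; lra.
rewrite ltr_norml /g => /andP[? ?].
by case: ifP => _; rewrite ?dotmulNr; lra.
Qed.

End Neighborliness.

(** * The null space property from lattice vectors *)

(** Maurey's empirical method. If the summands Z_1, ..., Z_s are independent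
    with values b l of probability p l, then g is their mean and the right-hand
    side is the expectation of Q (x + Z_1 + ... + Z_s), so that some outcome
    does not exceed it. The summands are chosen one by one, keeping the
    conditional expectation from increasing. *)
Lemma derandomized_maurey (R : realType) (V : lmodType R) (Q : V -> R)
    (B : V -> V -> R) (L : finType) (p : L -> R) (b : L -> V)
    (g := \sum_l p l *: b l) :
  (forall x y, Q (x + y) = Q x + B x y *+ 2 + Q y) ->
  (forall x y z, B x (y + z) = B x y + B x z) ->
  (forall x a y, B x (a *: y) = a * B x y) ->
  (forall l, 0 <= p l) -> \sum_l p l = 1 ->
  forall (s : nat) (x : V), exists f : L -> nat,
    (\sum_l f l = s)%N /\
    Q (x + \sum_l (f l)%:R *: b l) <=
      Q (x + s%:R *: g) + s%:R * (\sum_l p l * Q (b l) - Q g).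
Proof.
move=> QD BD BZ p0 p1; set v := _ - Q g.
have Bg x : B x g = \sum_l p l * B x (b l).
  rewrite /g; elim/big_rec2: _ => [|l y1 y2 _ IH].
    by have := BZ x 0 0; rewrite scale0r mul0r.
  by rewrite BD BZ IH.
have avg y : \sum_l p l * Q (y + b l) = Q (y + g) + v.
  rewrite (eq_bigr (fun l => p l * Q y + (p l * B y (b l)) *+ 2 + p l * Q (b l))).
    by rewrite !big_split/= -mulr_suml p1 mul1r QD Bg /v; ring.
  by move=> l _; rewrite QD; ring.
elim=> [|s IH] x.
  exists (fun=> 0%N); rewrite big1// mul0r scale0r big1 ?addr0//.
  by move=> l _; rewrite scale0r.
have [l Ql] : exists l, Q (x + s%:R *: g + b l) <= Q (x + s%:R *: g + g) + v.
  apply: contrapT => /forallNP H.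
  have : \sum_l p l * (Q (x + s%:R *: g + b l) - (Q (x + s%:R *: g + g) + v)) = 0.
    under eq_bigr do rewrite mulrBr.
    by rewrite sumrB avg -mulr_suml p1 mul1r subrr.
  have Hlt l : 0 < Q (x + s%:R *: g + b l) - (Q (x + s%:R *: g + g) + v).
    by rewrite subr_gt0 ltNge; apply/negP.
  move=> /eqP; rewrite psumr_eq0; last first.
    by move=> l _; apply: mulr_ge0 => //; apply: ltW; exact: Hlt.
  have [l pl] := weight_gt0 p0 p1.
  move=> /allP /(_ l); rewrite mem_index_enum => /(_ isT) /=.
  by rewrite mulf_eq0 !gt_eqF.
have [f [fs Qf]] := IH (x + b l).
exists (fun k => (f k + (k == l))%N); split.
  rewrite big_split/= fs (bigD1 l)//= eqxx big1 ?addn0 ?addn1// => k.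
  by move=> /negPf ->.
have -> : \sum_k (f k + (k == l))%:R *: b k = b l + \sum_k (f k)%:R *: b k.
  rewrite addrC (eq_bigr (fun k => (f k)%:R *: b k + (k == l)%:R *: b k)).
    rewrite big_split/=; congr (_ + _).
    rewrite (bigD1 l)//= eqxx scale1r big1 ?addr0// => k /negPf ->.
    by rewrite scale0r.
  by move=> k _; rewrite natrD scalerDl.
rewrite addrA; apply: le_trans Qf _.
have -> : x + b l + s%:R *: g = x + s%:R *: g + b l by rewrite addrAC.
rewrite -natr1 scalerDl scale1r addrA; move: Ql; lra.
Qed.

Lemma sqr_sum_le (R : realType) (I : finType) (D : {set I}) (a : I -> R) :
  (\sum_(i in D) a i) ^+ 2 <= #|D|%:R * \sum_(i in D) a i ^+ 2.
Proof.
set k : R := #|D|%:R; set s := \sum_(i in D) a i; set q := \sum_(i in D) _.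
have : 0 <= \sum_(i in D) (k * a i - s) ^+ 2 by apply: sumr_ge0 => i _; exact: sqr_ge0.
rewrite (eq_bigr (fun i =>
    k ^+ 2 * a i ^+ 2 - (k * s *+ 2) * a i + s ^+ 2)); last first.
  by move=> i _; ring.
rewrite big_split sumrB/= -!mulr_sumr sumr_const -/s -/q -mulr_natr -/k => H.
have : 0 <= k * (k * q - s ^+ 2) by move: H; rewrite mulr2n; nra.
have [D0 _|D0] := eqVneq #|D| 0%N.
  have E := cards0_eq D0.
  by rewrite /s /q E !finset.big_set0 expr0n mulr0.
by rewrite pmulr_rge0 ?subr_ge0// ltr0n lt0n.
Qed.

Section Transfer.
Variables (R : realType) (n N : nat) (A : 'M[R]_(n, N)).

(** The multiplicities f of the signed basis vectors e_j (flag true) and - e_j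
    (flag false) encode the integer vector that is their sum. Several f may give
    the same vector; f, unlike the vector, records the number of summands. *)
Definition lattice_vector (f : 'I_N * bool -> nat) (j : 'I_N) : R :=
  (f (j, true))%:R - (f (j, false))%:R.

Definition lower_isometry_on_lattice (s : nat) :=
  forall f : 'I_N * bool -> nat, (\sum_l f l = s)%N ->
    n%:R / 2 * \sum_j lattice_vector f j ^+ 2 <=
    \sum_i (\sum_j A i j * lattice_vector f j) ^+ 2.

(** Apply Maurey's method to Q x = |A x|^2 - (n/2) |x|^2, with h / |h|_1 as the
    mean of a random signed basis vector. The outcome is a lattice vector, so Q
    is nonnegative there; on the other side Q is negative at h, which has
    A h = 0, and at most 3 n at the basis vectors. *)
Lemma kernel_l2_le_l1 (s : nat) (h : 'cV[R]_N) :
  (0 < n)%N -> (0 < s)%N ->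
  (forall j, \sum_i A i j ^+ 2 <= 3 * n%:R) ->
  lower_isometry_on_lattice s -> A *m h = 0 ->
  (s%:R - 1) * \sum_j h j 0 ^+ 2 <= 6 * (\sum_j `|h j 0|) ^+ 2.
Proof.
move=> n0 s0 colA latA Ah; set M : R := \sum_j `|h j 0|.
have nR : 0 < n%:R :> R by rewrite ltr0n.
have sR : 0 < s%:R :> R by rewrite ltr0n.
have [M0|M0] := eqVneq M 0.
  rewrite M0 expr0n mulr0 [X in _ * X]big1 ?mulr0// => j _.
  have /eqP := M0; rewrite psumr_eq0// => /allP/(_ j).
  by rewrite mem_index_enum normr_eq0 => /(_ isT)/eqP ->; rewrite expr0n.
have Mp : 0 < M by rewrite lt0r M0 sumr_ge0.
pose B (x y : 'cV[R]_N) := \sum_i (A *m x) i 0 * (A *m y) i 0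
  - n%:R / 2 * \sum_j x j 0 * y j 0.
pose Q x := B x x.
have addE k (x y : 'cV[R]_k) i : (x + y) i 0 = x i 0 + y i 0 by rewrite mxE.
have scaleE k a (x : 'cV[R]_k) i : (a *: x) i 0 = a * x i 0 by rewrite mxE.
have BD (x y z : 'cV[R]_N) : B x (y + z) = B x y + B x z.
  rewrite /B mulmxDr.
  rewrite (eq_bigr (fun i =>
      (A *m x) i 0 * (A *m y) i 0 + (A *m x) i 0 * (A *m z) i 0)).
    rewrite (eq_bigr (fun j => x j 0 * y j 0 + x j 0 * z j 0)).
      by rewrite !big_split/=; ring.
    by move=> j _; rewrite addE mulrDr.
  by move=> i _; rewrite addE mulrDr.
have BZ (x : 'cV[R]_N) a y : B x (a *: y) = a * B x y.
  rewrite /B -scalemxAr mulrBr !mulr_sumr.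
  by congr (_ - _); apply: eq_bigr => i _; rewrite scaleE; ring.
have BC x y : B x y = B y x.
  by rewrite /B; congr (_ - _ * _); apply: eq_bigr => i _; rewrite mulrC.
have QD x y : Q (x + y) = Q x + B x y *+ 2 + Q y.
  by rewrite /Q BD [B (x + y) x]BC [B (x + y) y]BC !BD [B y x]BC; ring.
pose p (l : 'I_N * bool) : R :=
  (if l.2 then Num.max (h l.1 0) 0 else Num.max (- h l.1 0) 0) / M.
pose b (l : 'I_N * bool) : 'cV[R]_N :=
  (if l.2 then 1 else -1) *: delta_mx l.1 0.
have sumb (W : zmodType) (F : 'I_N * bool -> W) :
    \sum_l F l = \sum_j (F (j, true) + F (j, false)).
  transitivity (\sum_j \sum_s F (j, s)).
    by rewrite pair_bigA; apply: eq_bigr => -[].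
  by apply: eq_bigr => j _; rewrite big_bool.
have pE j : p (j, true) - p (j, false) = h j 0 / M.
  rewrite /p/= -mulrBl; congr (_ / _).
  by have [h0|h0] := lerP (h j 0) 0; [rewrite max_l|rewrite max_r]; lra.
have pE' j : p (j, true) + p (j, false) = `|h j 0| / M.
  rewrite /p/= -mulrDl; congr (_ / _).
  have [h0|h0] := lerP (h j 0) 0.
    by rewrite ler0_norm// max_l; lra.
  by rewrite gtr0_norm// max_r; lra.
have p0 l : 0 <= p l.
  by rewrite /p divr_ge0 ?(ltW Mp)//; case: ifP => _; rewrite le_max lexx orbT.
have p1 : \sum_l p l = 1.
  by rewrite sumb (eq_bigr _ (fun j _ => pE' j)) -mulr_suml divff.
have gE : \sum_l p l *: b l = M^-1 *: h.
  rewrite sumb; apply/colP => k; rewrite summxE !mxE (bigD1 k)//= big1 => [|j jk].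
    by rewrite !mxE !eqxx addr0 [RHS]mulrC -pE /=; ring.
  by rewrite !mxE eqxx andbT eq_sym (negPf jk) /=; ring.
have [f [fs]] := derandomized_maurey b QD BD BZ p0 p1 s 0.
rewrite !add0r gE.
have yE j : (\sum_l (f l)%:R *: b l) j 0 = lattice_vector f j.
  rewrite sumb summxE (bigD1 j)//= big1 => [|k kj].
    by rewrite !mxE !eqxx addr0 /lattice_vector /=; ring.
  by rewrite !mxE eqxx andbT eq_sym (negPf kj) /=; ring.
have QE x : Q x = \sum_i (\sum_j A i j * x j 0) ^+ 2 - n%:R / 2 * \sum_j x j 0 ^+ 2.
  by rewrite /Q /B; congr (_ - _ * _); apply: eq_bigr => i _; rewrite ?mxE expr2.
have Qf : 0 <= Q (\sum_l (f l)%:R *: b l).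
  rewrite QE subr_ge0; have := latA f fs.
  rewrite (eq_bigr _ (fun j _ => congr1 (fun t => t ^+ 2) (yE j))).
  move/le_trans; apply; rewrite le_eqVlt; apply/orP; left; apply/eqP.
  by apply: eq_bigr => i _; congr (_ ^+ 2); apply: eq_bigr => j _; rewrite yE.
move/(le_trans Qf); rewrite scalerA.
have QZ a x : Q (a *: x) = a ^+ 2 * Q x by rewrite /Q BZ BC BZ; ring.
have Qh : Q h = - (n%:R / 2 * \sum_j h j 0 ^+ 2).
  rewrite /Q /B Ah big1 ?sub0r; last by move=> i _; rewrite mxE mul0r.
  by congr (- (_ * _)); apply: eq_bigr => j _; rewrite expr2.
rewrite !QZ Qh; set q := \sum_j h j 0 ^+ 2.
have Qb : \sum_l p l * Q (b l) <= 3 * n%:R.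
  apply: le_trans (_ : \sum_l p l * (3 * n%:R) <= _); last first.
    by rewrite -mulr_suml p1 mul1r.
  apply: ler_sum => l _; apply: ler_wpM2l => //.
  have -> : Q (b l) = Q (delta_mx l.1 0).
    by rewrite /b QZ; case: ifP => _; rewrite ?sqrrN expr1n mul1r.
  rewrite /Q /B -colE; apply: le_trans (colA l.1).
  rewrite (eq_bigr (fun i => A i l.1 ^+ 2)) => [|i _]; last by rewrite !mxE expr2.
  rewrite gerBl mulr_ge0 ?divr_ge0// sumr_ge0// => j _.
  by rewrite -expr2 sqr_ge0.
set v := \sum_l _ in Qb *.
move=> H.
have q0 : 0 <= q by apply: sumr_ge0 => j _; exact: sqr_ge0.
have MV : M * M^-1 = 1 by rewrite divff.
have H1 : 0 <= s%:R * (- ((s%:R - 1) * (n%:R / 2 * (M^-1 ^+ 2 * q))) + 3 * n%:R).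
  by apply: le_trans H _; rewrite exprMn; nra.
rewrite pmulr_rge0// in H1.
have H2 : 0 <= n%:R * (6 - (s%:R - 1) * (M^-1 ^+ 2 * q)) by nra.
rewrite pmulr_rge0// subr_ge0 in H2.
have := @ler_wpM2r _ (M ^+ 2) _ _ _ H2; rewrite sqr_ge0 => /(_ isT).
by rewrite exprVn -mulrA [_^-1 * q]mulrC mulfVK// expf_neq0.
Qed.

(** If more than a third of the l1 mass of h sat on a set I with #|I| < m, then
    |h|_1^2 <= 9 #|I| |h|_2^2 by Cauchy-Schwarz, while the previous lemma gives
    (54 m - 1) |h|_2^2 <= 6 |h|_1^2; the constant 54 = 6 * 9 makes these two
    incompatible. *)
Lemma null_space_property_of_lattice (m : nat) :
  (0 < n)%N -> (0 < m)%N ->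
  (forall j, \sum_i A i j ^+ 2 <= 3 * n%:R) ->
  lower_isometry_on_lattice (54 * m) -> null_space_property m A.
Proof.
move=> n0 m0 colA latA h I Ah Im; rewrite leNgt; apply/negP => HI.
have s0 : (0 < 54 * m)%N by rewrite muln_gt0.
have := kernel_l2_le_l1 n0 s0 colA latA Ah.
set q := \sum_j _; rewrite (bigID (mem I))/=.
have CS := sqr_sum_le I (fun j => `|h j 0|).
move: HI CS; set a := \sum_(i in I) `|h i 0|; set c := \sum_(i | _) _ => HI CS.
have c0 : 0 <= c by apply: sumr_ge0.
have a0 : 0 < a by lra.
have Iq : \sum_(i in I) `|h i 0| ^+ 2 <= q.
  rewrite /q [leRHS](bigID (mem I))/= (eq_bigr (fun i => h i 0 ^+ 2)).
    by rewrite lerDl sumr_ge0// => i _; exact: sqr_ge0.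
  by move=> i _; rewrite real_normK// num_real.
have kR : #|I|%:R <= m%:R - 1 :> R.
  by rewrite lerBrDr natr1 ler_nat.
have q0 : 0 <= q by apply: sumr_ge0 => j _; exact: sqr_ge0.
have aq : a ^+ 2 <= (m%:R - 1) * q.
  apply: le_trans CS _; apply: le_trans (ler_wpM2l _ Iq) _ => //.
  by rewrite ler_wpM2r.
have qp : 0 < q.
  rewrite lt0r q0 andbT; apply/eqP => qE; move: aq; rewrite qE mulr0.
  by rewrite leNgt exprn_gt0.
have ac : (a + c) ^+ 2 <= 9 * a ^+ 2.
  have -> : 9 * a ^+ 2 = (3 * a) ^+ 2 by ring.
  by rewrite ler_sqr ?nnegrE; lra.
rewrite natrM => H; have : (54%:R * m%:R - 1) * q <= 54 * ((m%:R - 1) * q).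
  by apply: le_trans H _; lra.
by nra.
Qed.

End Transfer.

(** * Counting lattice vectors *)

Section Counting.
Variable R : realType.

(** Rankin's trick: each f contributes x ^+ s to the expansion of the product
    over L of the truncated geometric series in x. *)
Lemma card_compositions_le (L : finType) (s : nat) (x : R) : 0 < x -> x <= 1 / 2 ->
  #|[set f : {ffun L -> 'I_s.+1} | (\sum_l f l == s)%N]%SET|%:R * x ^+ s
    <= expR (2 * x * #|L|%:R).
Proof.
move=> x0 x1; set F := [set f | _]%SET.
have xe (k : nat) : 0 <= x ^+ k by rewrite exprn_ge0// ltW.
have -> : #|F|%:R * x ^+ s = \sum_(f in F) \prod_l x ^+ f l.
  rewrite (eq_bigr (fun=> x ^+ s)); first by rewrite sumr_const mulr_natl.
  by move=> f; rewrite inE => /eqP fs; rewrite prodrXr fs.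
have geo : \sum_(k < s.+1) x ^+ k <= expR (2 * x).
  apply: le_trans (expR_ge1Dx _).
  have : (1 - x) * \sum_(k < s.+1) x ^+ k = 1 - x ^+ s.+1.
    by rewrite -[in RHS](opprB (x ^+ s.+1)) subrX1 -mulNr opprB.
  set g := \sum_(k < _) _ => gE.
  have g1 : (1 - x) * g <= 1 by rewrite gE; have := xe s.+1; lra.
  rewrite -(@ler_pM2l _ (1 - x)); last by lra.
  by apply: le_trans g1 _; nra.
apply: (@le_trans _ _ (\sum_(f : {ffun L -> 'I_s.+1}) \prod_l x ^+ f l)).
  rewrite [leRHS](bigID (mem F))/= lerDl; apply: sumr_ge0 => f _.
  by apply: prodr_ge0.
rewrite -(bigA_distr_bigA (fun (l : L) (k : 'I_s.+1) => x ^+ k)).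
rewrite prodr_const [2 * x * _]mulrC expRM_natl.
rewrite lerXn2r ?nnegrE ?expR_ge0//.
by apply: sumr_ge0.
Qed.

End Counting.

(** * Independence of blocks of variables *)

Section Independence.
Context d (T : measurableType d) (R : realType) (P : probability T R).
Implicit Types U V : T -> R.

Definition independent2 U V := forall A B : set R,
  measurable A -> measurable B ->
  P (U @^-1` A `&` V @^-1` B) = (P (U @^-1` A) * P (V @^-1` B))%E.

(** The law of (U, V) agrees with the product of the laws on rectangles, hence
    everywhere. *)
Lemma independent2_tonelli U V (F : R * R -> R) :
  measurable_fun [set: T] U -> measurable_fun [set: T] V -> independent2 U V ->
  measurable_fun [set: R * R] F -> (forall z, 0 <= F z) ->
  (\int[P]_t (F (U t, V t))%:E = \int[P]_t \int[P]_s (F (U t, V s))%:E)%E.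
Proof.
move=> mU mV UV mF F0.
pose U' : {mfun T >-> R} := HB.pack U (isMeasurableFun.Build _ _ _ _ _ mU).
pose V' : {mfun T >-> R} := HB.pack V (isMeasurableFun.Build _ _ _ _ _ mV).
pose W' : {mfun T >-> (R * R)%type} := HB.pack (fun t => (U t, V t))
  (isMeasurableFun.Build _ _ _ _ _ (measurable_fun_pair mU mV)).
have mF' : measurable_fun [set: R * R] (fun z => (F z)%:E) by exact/measurable_EFinP.
have F0' z : (0 <= (F z)%:E)%E by rewrite lee_fin.
have -> : (\int[P]_t (F (U t, V t))%:E = \int[distribution P W']_z (F z)%:E)%E.
  by rewrite (@ge0_integral_distribution _ _ _ _ _ P W' (fun z => (F z)%:E)).
have -> : (\int[distribution P W']_z (F z)%:E =
    \int[distribution P U' \x distribution P V']_z (F z)%:E)%E.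
  apply: eq_measure_integral => A mA _; apply/esym.
  by apply: product_measure_unique => // B C mB mC; exact: UV.
rewrite (@fubini_tonelli1 _ _ _ _ _ _ _ (fun z => (F z)%:E))//.
rewrite (@ge0_integral_distribution _ _ _ _ _ P U').
- apply: eq_integral => t _; rewrite /fubini_F /=.
  rewrite (@ge0_integral_distribution _ _ _ _ _ P V' (fun y => (F (U t, y))%:E))//.
  apply/measurable_EFinP; apply: measurableT_comp => //.
- exact: measurable_fun_fubini_tonelli_F.
- by move=> x; apply: integral_ge0.
Qed.

Lemma independent2_prod U V :
  measurable_fun [set: T] U -> measurable_fun [set: T] V -> independent2 U V ->
  (forall t, 0 <= U t) -> (forall t, 0 <= V t) ->
  (\int[P]_t (U t * V t)%:E = \int[P]_t (U t)%:E * \int[P]_t (V t)%:E)%E.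
Proof.
move=> mU mV UV U0 V0.
pose F (z : R * R) : R := `|z.1| * `|z.2|.
have mF : measurable_fun [set: R * R] F.
  by apply: measurable_funM; apply: measurableT_comp => //; exact: normr_measurable.
have F0 z : 0 <= F z by rewrite mulr_ge0.
have := independent2_tonelli mU mV UV mF F0; rewrite /F /=.
under eq_integral do rewrite !ger0_norm//; move=> ->.
under eq_integral => t _.
  under eq_integral do rewrite !ger0_norm// EFinM.
  rewrite ge0_integralZl//=; first by over.
  - exact/measurable_EFinP.
  - by move=> s _; rewrite lee_fin.
  - by rewrite lee_fin.
rewrite ge0_integralZr//.
- exact/measurable_EFinP.
- by move=> t _; rewrite lee_fin.
- by apply: integral_ge0 => t _; rewrite lee_fin.
Qed.

Section Blocks.
Context (I : finType) (X : I -> {RV P >-> R}).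
Hypothesis indX : mutually_independent X.
Implicit Types J K : {set I}.

Definition cylinders J : set (set T) :=
  [set E | exists B : I -> set R, (forall i, measurable (B i)) /\
     E = \bigcap_(i in [set` J]) (X i @^-1` B i)].

(** Measurability with respect to the sigma-algebra generated by the variables
    of the block J. *)
Definition depends_on J U :=
  measurable_fun [set: g_sigma_algebraType (cylinders J)]
    (U : g_sigma_algebraType (cylinders J) -> R).

Lemma cylinders_measurable J : cylinders J `<=` @measurable _ T.
Proof.
move=> _ [B [mB ->]]; apply: fin_bigcap_measurable => // i _.
by rewrite -[X in measurable X]setTI; exact: measurable_funP.
Qed.

Lemma cylindersT J : cylinders J setT.
Proof.
exists (fun=> setT); split=> //; apply/seteqP; split=> // t _ i _ //=.
Qed.

Lemma cylinders_setI J : setI_closed (cylinders J).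
Proof.
move=> _ _ [B [mB ->]] [C [mC ->]]; exists (fun i => B i `&` C i); split.
  by move=> i; exact: measurableI.
apply/seteqP; split=> t.
  by move=> [tB tC] i iJ; split; [exact: tB|exact: tC].
by move=> tBC; split=> i iJ; have [] := tBC i iJ.
Qed.

Lemma sub_cylinders J K : J \subset K -> cylinders J `<=` cylinders K.
Proof.
move=> JK _ [B [mB ->]]; exists (fun i => if i \in J then B i else setT); split.
  by move=> i; case: ifP.
apply/seteqP; split=> t tB i /=.
  by move=> iK; case: ifPn => // iJ; exact: tB.
by move=> iJ; have := tB i (fintype.subsetP JK i iJ); rewrite /= iJ.
Qed.

Lemma cylinders_independent J K E F : [disjoint J & K]%B ->
  cylinders J E -> cylinders K F -> P (E `&` F) = (P E * P F)%E.
Proof.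
move=> JK [B [mB ->]] [C [mC ->]].
pose D i := if i \in J then B i else C i.
have DC i : i \in K -> D i = C i.
  by move=> iK; rewrite /D (disjointFl JK).
have mD i : measurable (D i) by rewrite /D; case: ifP.
have -> : \bigcap_(i in [set` J]) (X i @^-1` B i) `&`
    \bigcap_(i in [set` K]) (X i @^-1` C i) =
    \bigcap_(i in [set` (J :|: K)%SET]) (X i @^-1` D i).
  apply/seteqP; split=> t.
    move=> [tB tC] i /=; rewrite inE => /orP[iJ|iK].
      by rewrite /D iJ; exact: tB.
    by rewrite DC//; exact: tC.
  move=> tD; split=> i /= iJ.
    by have := tD i; rewrite /= inE iJ /D iJ; apply.
  by have := tD i; rewrite /= inE iJ orbT DC//; apply.
rewrite !indX// (eq_bigl [predU J & K]); last by move=> i; rewrite !inE.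
rewrite bigU//=; congr (_ * _)%E; apply: eq_bigr => i iJ.
  by rewrite /D iJ.
by rewrite DC.
Qed.

(** Uniqueness of measures on a pi-system, applied twice: first to the measures
    P (- `&` F) and P F * P - for a cylinder F, then with the roles of the
    two blocks exchanged. *)
Lemma blocks_independent J K E F : [disjoint J & K]%B ->
  <<s cylinders J >> E -> <<s cylinders K >> F -> P (E `&` F) = (P E * P F)%E.
Proof.
have msig L : <<s cylinders L >> `<=` @measurable _ T.
  by apply: smallest_sub; [exact: sigma_algebra_measurable|exact: cylinders_measurable].
have step (L : {set I}) (F' : set T) : measurable F' ->
    (forall E', cylinders L E' -> P (E' `&` F') = (P E' * P F')%E) ->
    forall E', <<s cylinders L >> E' -> P (E' `&` F') = (P E' * P F')%E.
  move=> mF' H E' sE'.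
  have PF0 : 0 <= fine (P F') by apply: fine_ge0.
  have Pfin : P F' = (fine (P F'))%:E by rewrite fineK// fin_num_measure.
  have := @g_sigma_algebra_measure_unique _ R T (cylinders L)
    (@cylinders_measurable L) (fun=> setT) (fun=> cylindersT L) _
    (mrestr P mF') (mscale (NngNum PF0) P) (@cylinders_setI L) _ _ E' sE'.
  have mE A : mrestr P mF' A = P (A `&` F') by [].
  have sE A : mscale (NngNum PF0) P A = (P A * P F')%E.
    by rewrite muleC [in RHS]Pfin.
  move=> uniq_ext; rewrite -mE -sE; apply: uniq_ext.
  - by apply/seteqP; split=> // t _; exists 0%N.
  - by move=> A LA; exact: etrans (mE A) (etrans (H _ LA) (esym (sE A))).
  - move=> _; change (P (setT `&` F') < +oo)%E; rewrite setTI.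
    by apply: le_lt_trans (probability_le1 P mF') _; exact: ltry.
move=> JK sE sF; apply: (step J F (msig _ _ sF) _ E sE) => E' cE'.
rewrite setIC muleC.
apply: (step K E' (cylinders_measurable cE') _ F sF) => F' cF'.
by rewrite setIC muleC; exact: cylinders_independent JK _ _.
Qed.

Lemma depends_on_measurable J U : depends_on J U -> measurable_fun [set: T] U.
Proof.
move=> mU _ B mB; have := mU measurableT B mB; apply: smallest_sub => //.
  exact: sigma_algebra_measurable.
exact: cylinders_measurable.
Qed.

Lemma depends_on_coordinate J i : i \in J -> depends_on J (X i).
Proof.
move=> iJ _ B mB; apply: sub_sigma_algebra.
exists (fun k => if k == i then B else setT); split.
  by move=> k; case: ifP.
rewrite setTI; apply/seteqP; split=> t tB.
  by move=> k _ /=; case: eqVneq => [->|].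
by have := tB i iJ; rewrite /= eqxx.
Qed.

Lemma depends_on_sub J K U : J \subset K -> depends_on J U -> depends_on K U.
Proof.
move=> JK mU _ B mB; have := mU measurableT B mB.
by apply: sub_sigma_algebra2; exact: sub_cylinders.
Qed.

Lemma depends_on_independent J K U V : [disjoint J & K]%B ->
  depends_on J U -> depends_on K V -> independent2 U V.
Proof.
move=> JK mU mV A B mA mB; apply: (blocks_independent JK).
  by have := mU measurableT A mA; rewrite setTI.
by have := mV measurableT B mB; rewrite setTI.
Qed.

Lemma integral_prod_blocks (L : eqType) (s : seq L) (J : L -> {set I})
    (U : L -> T -> R) :
  uniq s -> (forall l k, l != k -> [disjoint J l & J k]%B) ->
  (forall l, depends_on (J l) (U l)) -> (forall l t, 0 <= U l t) ->
  (\int[P]_t (\prod_(l <- s) U l t)%:E = \prod_(l <- s) \int[P]_t (U l t)%:E)%E.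
Proof.
move=> us dJ mU U0; elim: s us => [|l s IH] /=.
  move=> _; under eq_integral do rewrite big_nil.
  by rewrite big_nil integral_cst//= probability_setT mule1.
move=> /andP[ls us].
under eq_integral do rewrite big_cons.
rewrite independent2_prod ?big_cons ?IH//.
- exact: depends_on_measurable (mU l).
- by apply: measurable_prod => k _; exact: depends_on_measurable (mU k).
- apply: (@depends_on_independent (J l) (\bigcup_(k <- s) J k)%SET).
  + rewrite disjoint_sym; elim: s ls {us IH} => [|k s IHs].
      by move=> _; rewrite big_nil; apply/pred0P => i; rewrite !inE.
    rewrite inE negb_or => /andP[lk ls]; rewrite big_cons.
    apply/pred0P => i; rewrite !inE.
    have := pred0P (IHs ls) i; have := pred0P (dJ _ _ lk) i => /=.
    by case: (i \in J l) => /=; rewrite ?andbF// !andbT => -> ->.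
  + exact: mU.
  + apply: measurable_prod => k ks; apply: depends_on_sub (mU k).
    by rewrite (big_rem k)//= finset.subsetUl.
- by move=> t; apply: prodr_ge0 => k _.
Qed.

End Blocks.
End Independence.

(** * Exponential inequalities *)

Section RealInequalities.
Context (R : realType).
Implicit Types x u r : R.

Lemma expR_ge_sqr x : 0 <= x -> 1 + x ^+ 2 / 2 <= expR x.
Proof. exact: (@expR_ge1Dxn _ _ 1). Qed.

Lemma expR_ge_quartic x : 0 <= x -> x ^+ 4 <= 24 * expR x.
Proof.
move=> x0; have := @expR_ge1Dxn _ _ 3 x0.
by rewrite -[_`!]/24%N; set y := x ^+ 4; lra.
Qed.

Lemma expR_le_1DxDsqr x : 0 <= x -> expR x <= 1 + x + x ^+ 2 * expR x.
Proof.
move=> x0; have e0 := expR_gt0 x; have h := expR_ge1Dx (- x).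
have h1 : (1 - x) * expR x <= 1.
  have := ler_wpM2r (ltW e0) h.
  by rewrite -expRD addNr expR0.
have : (1 + x) * ((1 - x) * expR x) <= (1 + x) * 1 by rewrite ler_wpM2l//; lra.
by move: (expR x) => e; nra.
Qed.

(** Both bounds come from 1 + x <= expR x: multiply the lower bound of expR (- x)
    by 1 + x in the previous lemma, and invert that of expR x here. *)
Lemma expRN_le_1BxDsqr x : 0 <= x -> expR (- x) + x <= 1 + x ^+ 2.
Proof.
move=> x0; have h := expR_ge1Dx x.
have e : expR (- x) * (1 + x) <= 1.
  have := ler_wpM2l (expR_ge0 (- x)) h.
  by rewrite -expRD addNr expR0.
have x3 : 0 <= x ^+ 3 by rewrite exprn_ge0.
rewrite -lerBrDr -(@ler_pM2r _ (1 + x)); last by lra.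
apply: le_trans e _.
have -> : (1 + x ^+ 2 - x) * (1 + x) = 1 + x ^+ 3 by ring.
by lra.
Qed.

(** For r between 1 and 2 the power u `^ r lies between u and u ^+ 2, which
    reduces estimates uniform in r to these two extreme cases. *)
Lemma powR_between u r : 0 <= u -> 1 <= r -> r <= 2 ->
  u <= 1 /\ u ^+ 2 <= u `^ r \/ 1 <= u /\ u <= u `^ r.
Proof.
move=> u0 r1 r2; have [->|up] := eqVneq u 0.
  by left; split=> //; rewrite powR0 ?expr0n//; lra.
have up' : 0 < u by rewrite lt0r up.
have [u1|u1] := lerP u 1; [left|right]; split=> //; last 2 first.
- exact: ltW.
- by apply: le1r_powR => //; exact: ltW.
by rewrite -powR_mulrn//; apply: ger_powR => //; rewrite up' u1.
Qed.

Lemma quartic_le_expR_half_powR u r : 0 <= u -> 1 <= r -> r <= 2 ->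
  u ^+ 4 <= 384 * expR (u `^ r / 2).
Proof.
move=> u0 r1 r2; have x0 : 0 <= u `^ r / 2 by rewrite divr_ge0// powR_ge0.
have [[u1 _]|[u1 uu]] := powR_between u0 r1 r2.
  have : u ^+ 4 <= 1 by rewrite exprn_ile1.
  by have := expR_ge1Dx (u `^ r / 2); lra.
have := expR_ge_quartic x0.
have : (u / 2) ^+ 4 <= (u `^ r / 2) ^+ 4 by rewrite lerXn2r ?nnegrE; lra.
have -> : (u / 2) ^+ 4 = u ^+ 4 / 16 by field.
by set y := u ^+ 4; lra.
Qed.

Lemma quartic_le_expR_powR u r : 0 <= u -> 1 <= r -> r <= 2 ->
  u ^+ 4 <= 24 * expR (u `^ r).
Proof.
move=> u0 r1 r2; have x0 : 0 <= u `^ r by rewrite powR_ge0.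
have [[u1 _]|[u1 uu]] := powR_between u0 r1 r2.
  have : u ^+ 4 <= 1 by rewrite exprn_ile1.
  by have := expR_ge1Dx (u `^ r); lra.
apply: le_trans (expR_ge_quartic x0).
by rewrite lerXn2r ?nnegrE//.
Qed.

Lemma sqr_le_expR_powR u r : 0 <= u -> 1 <= r -> r <= 2 ->
  1 + u ^+ 2 / 2 <= expR (u `^ r).
Proof.
move=> u0 r1 r2; have x0 : 0 <= u `^ r by rewrite powR_ge0.
have [[u1 uu]|[u1 uu]] := powR_between u0 r1 r2.
  by have := expR_ge1Dx (u `^ r); have := sqr_ge0 u; lra.
apply: le_trans (expR_ge_sqr x0).
have : u ^+ 2 <= u `^ r ^+ 2 by rewrite lerXn2r ?nnegrE.
by lra.
Qed.

End RealInequalities.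

(** * Moments of psi_r variables *)

Section Moments.
Context d (T : measurableType d) (R : realType) (P : probability T R).
Implicit Types (a : T -> R) (q r : R).

(** The psi_r condition is an integral bound at the scale q itself: the infimum
    that defines the psi_r norm need not be attained a priori, but the bound
    holds at every scale larger than the norm. *)
Record standard_psi q r a : Prop := StandardPsi {
  sp_measurable : measurable_fun [set: T] a;
  sp_mean : (\int[P]_t (a t)%:E = 0)%E;
  sp_variance : (\int[P]_t (a t ^+ 2)%:E = 1)%E;
  sp_psi : (\int[P]_t (expR ((`|a t| / q) `^ r))%:E <= 2%:E)%E
}.

Lemma integral_mono (f g : T -> R) :
  measurable_fun [set: T] f -> measurable_fun [set: T] g ->
  (forall t, 0 <= f t) -> (forall t, f t <= g t) ->
  (\int[P]_t (f t)%:E <= \int[P]_t (g t)%:E)%E.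
Proof.
move=> mf mg f0 fg; apply: ge0_le_integral => //.
- by move=> t _; rewrite lee_fin.
- exact/measurable_EFinP.
- exact/measurable_EFinP.
- by move=> t _; rewrite lee_fin.
Qed.

Lemma integral_lincomb (k : R) (f g : T -> R) :
  measurable_fun [set: T] f -> measurable_fun [set: T] g ->
  (forall t, 0 <= f t) -> (forall t, 0 <= g t) -> 0 <= k ->
  (\int[P]_t (f t + k * g t)%:E =
    \int[P]_t (f t)%:E + k%:E * \int[P]_t (g t)%:E)%E.
Proof.
move=> mf mg f0 g0 k0; under eq_integral do rewrite EFinD EFinM.
rewrite ge0_integralD//=.
- rewrite ge0_integralZl//; first exact/measurable_EFinP.
  by move=> t _; rewrite lee_fin.
- by move=> t _; rewrite lee_fin.
- exact/measurable_EFinP.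
- by move=> t _; rewrite lee_fin mulr_ge0.
- by apply/measurable_EFinP; apply: measurable_funM.
Qed.

Lemma integral_affine (c k : R) (f : T -> R) :
  measurable_fun [set: T] f -> (forall t, 0 <= f t) -> 0 <= c -> 0 <= k ->
  (\int[P]_t (c + k * f t)%:E = c%:E + k%:E * \int[P]_t (f t)%:E)%E.
Proof.
move=> mf f0 c0 k0; rewrite integral_lincomb//.
by rewrite integral_cst//= probability_setT mule1.
Qed.

Lemma measurable_powR_norm q r a : measurable_fun [set: T] a ->
  measurable_fun [set: T] (fun t => (`|a t| / q) `^ r).
Proof.
move=> ma; apply: (measurableT_comp (measurable_powR r)).
by apply: measurable_funM => //; apply: measurableT_comp.
Qed.

Lemma measurable_expR_psi q r a : measurable_fun [set: T] a ->
  measurable_fun [set: T] (fun t => expR ((`|a t| / q) `^ r)).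
Proof. by move=> ma; apply: measurableT_comp => //; exact: measurable_powR_norm. Qed.

(** Since expR (u `^ r) >= 1 + u ^+ 2 / 2, variance one prevents the psi_r norm
    from being small. *)
Lemma second_moment_le_psi q r a : 0 < q -> 1 <= r -> r <= 2 ->
  measurable_fun [set: T] a -> (\int[P]_t (a t ^+ 2)%:E = 1)%E ->
  (\int[P]_t (expR ((`|a t| / q) `^ r))%:E <= 2%:E)%E -> 1 / 2 <= q ^+ 2.
Proof.
move=> q0 r1 r2 ma a2 aq.
have mexp := measurable_expR_psi q r ma.
have m2 : measurable_fun [set: T] (fun t => a t ^+ 2) by exact: measurable_funX.
have : (1 + (1 / (2 * q ^+ 2))%:E * \int[P]_t (a t ^+ 2)%:E <= 2%:E)%E.
  apply: le_trans aq.
  rewrite -integral_affine//; last 2 first.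
  - by move=> t; exact: sqr_ge0.
  - by rewrite divr_ge0// mulr_ge0// sqr_ge0.
  apply: integral_mono => //.
  - by apply: measurable_funD => //; apply: measurable_funM.
  - by move=> t; rewrite addr_ge0// mulr_ge0 ?sqr_ge0// divr_ge0// mulr_ge0// sqr_ge0.
  move=> t; have u0 : 0 <= `|a t| / q by rewrite divr_ge0// ltW.
  apply: le_trans (sqr_le_expR_powR u0 r1 r2).
  rewrite expr_div_n real_normK ?num_real//.
  rewrite le_eqVlt; apply/orP; left; apply/eqP; field.
  by rewrite gt_eqF.
rewrite a2 mule1 -EFinD lee_fin => h.
have q2 : 0 < q ^+ 2 by rewrite exprn_gt0.
have : 1 / (2 * q ^+ 2) <= 1 by lra.
by rewrite ler_pdivrMr ?mul1r; lra.
Qed.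

Lemma psi_norm_bound r a (psi q : R) : 1 <= r ->
  (psi_norm P r a <= psi%:E)%E -> psi < q -> measurable_fun [set: T] a ->
  0 < q /\ (\int[P]_t (expR ((`|a t| / q) `^ r))%:E <= 2%:E)%E.
Proof.
move=> r1 apsi psiq ma.
have : (psi_norm P r a < q%:E)%E by apply: le_lt_trans apsi _; rewrite lte_fin.
move=> /ereal_inf_lt[_ [C [C0 aC] <-]]; rewrite lte_fin => Cq.
have q0 : 0 < q by apply: lt_trans Cq.
split=> //; apply: le_trans aC; rewrite unlock.
apply: integral_mono; try exact: measurable_expR_psi.
- by move=> t; exact: expR_ge0.
move=> t; rewrite ler_expR; apply: ge0_ler_powR.
- by lra.
- by rewrite nnegrE divr_ge0// ltW.
- by rewrite nnegrE divr_ge0// ltW.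
- by rewrite ler_wpM2l// lef_pV2// ?posrE// ltW.
Qed.

(** The previous bound fails at the scale 1/2, hence psi >= 1/2, and 2 * psi is
    larger than the psi_r norm. *)
Lemma standard_psi_of_norm r psi (a : {RV P >-> R}) :
  1 <= r -> r <= 2 -> ('E_P[a] = 0)%E -> ('V_P[a] = 1)%E ->
  (psi_norm P r a <= psi%:E)%E ->
  1 / 2 <= psi /\ standard_psi (2 * psi) r a.
Proof.
move=> r1 r2 Ea Va apsi.
have ma : measurable_fun [set: T] a by [].
have a2 : (\int[P]_t (a t ^+ 2)%:E = 1)%E.
  move: Va; rewrite /variance unlock Ea /= unlock => <-.
  apply: eq_integral => t _; rewrite expr2.
  by transitivity ((a t - 0) * (a t - 0))%:E => //; rewrite subr0.
have psi2 : 1 / 2 <= psi.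
  rewrite leNgt; apply/negP => psi_lt.
  have [q0 aq] := psi_norm_bound r1 apsi psi_lt ma.
  by have := second_moment_le_psi q0 r1 r2 ma a2 aq; rewrite expr_div_n; lra.
split=> //; split=> //; first by move: Ea; rewrite unlock.
by have [|] := psi_norm_bound (q := 2 * psi) r1 apsi _ ma; first by lra.
Qed.

Section StandardPsi.
Variables (q r : R) (a : T -> R).
Hypotheses (q1 : 1 <= q) (r1 : 1 <= r) (r2 : r <= 2).
Hypothesis aP : standard_psi q r a.
Let ma := sp_measurable aP.
Let q0 : 0 < q. Proof. by apply: lt_le_trans q1. Qed.
Let u0 t : 0 <= `|a t| / q. Proof. by rewrite divr_ge0// ltW. Qed.
Let measurable_a k : measurable_fun [set: T] (fun t => a t ^+ k).
Proof. exact: measurable_funX. Qed.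

Let a4E t : a t ^+ 4 = q ^+ 4 * (`|a t| / q) ^+ 4.
Proof.
rewrite expr_div_n mulrCA mulfV ?mulr1 ?expf_neq0 ?gt_eqF//.
by rewrite -normrX ger0_norm// (exprM _ 2 2) sqr_ge0.
Qed.

Lemma fourth_moment : (\int[P]_t (a t ^+ 4)%:E <= (48 * q ^+ 4)%:E)%E.
Proof.
have -> : (48 * q ^+ 4 = 24 * q ^+ 4 * 2 :> R)%R by ring.
rewrite EFinM; have c0 : 0 <= 24 * q ^+ 4 by rewrite mulr_ge0// exprn_ge0// ltW.
have c0' : (0 <= (24 * q ^+ 4)%:E)%E by rewrite lee_fin.
apply: le_trans (lee_wpmul2l c0' (sp_psi aP)).
rewrite -ge0_integralZl//.
  - under [leRHS]eq_integral do rewrite -EFinM.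
    apply: integral_mono => //.
    + by apply: measurable_funM => //; exact: measurable_expR_psi.
    + by move=> t; rewrite (exprM _ 2 2) sqr_ge0.
    + move=> t; rewrite a4E.
      rewrite [leRHS](_ : _ = q ^+ 4 * (24 * expR ((`|a t| / q) `^ r))); last by ring.
      rewrite ler_wpM2l ?exprn_ge0 ?(ltW q0)//.
      exact: quartic_le_expR_powR.
  - by apply/measurable_EFinP; exact: measurable_expR_psi.
Qed.

Lemma integrable_powers : [/\ P.-integrable setT (EFin \o a),
  P.-integrable setT (EFin \o (fun t => a t ^+ 2)) &
  P.-integrable setT (EFin \o (fun t => a t ^+ 4))].
Proof.
have i2 : P.-integrable setT (EFin \o (fun t => a t ^+ 2)).
  apply/integrableP; split; first exact/measurable_EFinP.
  under eq_integral do rewrite /= ger0_norm ?sqr_ge0//.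
  by rewrite (sp_variance aP) ltry.
have i4 : P.-integrable setT (EFin \o (fun t => a t ^+ 4)).
  apply/integrableP; split; first exact/measurable_EFinP.
  under eq_integral do rewrite /= ger0_norm ?(exprM _ 2 2) ?sqr_ge0//.
  under eq_integral do rewrite -exprM.
  by apply: le_lt_trans fourth_moment _; rewrite ltry.
split=> //; apply/integrableP; split; first exact/measurable_EFinP.
apply: (@le_lt_trans _ _ (\int[P]_t (1 + 1 * a t ^+ 2)%:E)%E).
  apply: (@integral_mono (fun t => `|a t|) (fun t => 1 + 1 * a t ^+ 2)) => //.
  - exact: measurableT_comp.
  - by apply: measurable_funD => //; exact: measurable_funM.
  - by move=> t; have := real_normK (num_real (a t)); have := sqr_ge0 (`|a t| - 1); nra.
rewrite integral_affine//; last by move=> t; exact: sqr_ge0.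
by rewrite (sp_variance aP) -EFinM -EFinD ltry.
Qed.

Lemma integral_quartic_without_cubic (c0 c1 c2 c4 : R) :
  (\int[P]_t (c0 + c1 * a t + c2 * a t ^+ 2 + c4 * a t ^+ 4)%:E =
   (c0 + c2)%:E + c4%:E * \int[P]_t (a t ^+ 4)%:E)%E.
Proof.
have [i1 i2 i4] := integrable_powers.
have ic c : P.-integrable setT (EFin \o cst c : T -> \bar R).
  by apply: finite_measure_integrable_cst.
have iZ c (f : T -> R) : P.-integrable setT (EFin \o f) ->
    P.-integrable setT (fun t => (c * f t)%:E).
  by move=> fi; have := integrableZl measurableT c fi; apply: eq_integrable => // t _.
have i01 : P.-integrable setT (fun t => (c0 + c1 * a t)%:E).
  by have := integrableD measurableT (ic c0) (iZ c1 _ i1); apply: eq_integrable.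
have i012 : P.-integrable setT (fun t => (c0 + c1 * a t + c2 * a t ^+ 2)%:E).
  by have := integrableD measurableT i01 (iZ c2 _ i2); apply: eq_integrable.
under eq_integral do rewrite EFinD.
rewrite integralD//; last exact: iZ.
under [X in (X + _)%E]eq_integral do rewrite EFinD.
rewrite integralD//; last exact: iZ.
under [X in (X + _ + _)%E]eq_integral do rewrite EFinD.
rewrite integralD//; [|exact: ic|exact: iZ].
under [X in (_ + X + _ + _)%E]eq_integral do rewrite EFinM.
under [X in (_ + X + _)%E]eq_integral do rewrite EFinM.
under [X in (_ + X)%E]eq_integral do rewrite EFinM.
rewrite !integralZl// (sp_mean aP) (sp_variance aP) mule0 adde0 mule1.
by rewrite integral_cst//= probability_setT mule1 EFinD.
Qed.

(** The hypothesis on lambda keeps the exponent below half of (x / q) `^ r. The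
    other half absorbs the factor a ^+ 4 of the second-order term of the
    exponential. *)
Lemma truncated_mgf (lambda M : R) : 0 <= lambda -> 0 <= M ->
  (forall x, 0 <= x -> lambda * Num.min (x ^+ 2) M <= (x / q) `^ r / 2) ->
  (\int[P]_t (expR (lambda * Num.min (a t ^+ 2) M))%:E <=
    (1 + lambda + 768 * q ^+ 4 * lambda ^+ 2)%:E)%E.
Proof.
move=> l0 M0 lM.
have mm : measurable_fun [set: T] (fun t => lambda * Num.min (a t ^+ 2) M).
  by apply: measurable_funM => //; apply: measurable_minr.
have min0 t : 0 <= lambda * Num.min (a t ^+ 2) M.
  by rewrite mulr_ge0// le_min sqr_ge0.
have c0 : 0 <= 384 * q ^+ 4 * lambda ^+ 2.
  apply: mulr_ge0; last exact: sqr_ge0.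
  by apply: mulr_ge0; [exact: ler0n|apply: exprn_ge0; exact: ltW].
have me := measurable_expR_psi q r ma.
apply: (@le_trans _ _ (\int[P]_t
    ((1 + lambda * a t ^+ 2) +
     384 * q ^+ 4 * lambda ^+ 2 * expR ((`|a t| / q) `^ r))%:E)%E).
  apply: integral_mono.
  - exact: measurableT_comp.
  - by apply: measurable_funD; [apply: measurable_funD => //|];
      apply: measurable_funM.
  - by move=> t; exact: expR_ge0.
  move=> t; apply: le_trans (expR_le_1DxDsqr (min0 t)) _.
  have mle : Num.min (a t ^+ 2) M <= a t ^+ 2 by rewrite ge_min lexx.
  have min0' : 0 <= Num.min (a t ^+ 2) M by rewrite le_min sqr_ge0.
  rewrite lerD ?lerD2l ?ler_wpM2l//.
  have e1 : expR (lambda * Num.min (a t ^+ 2) M) <= expR ((`|a t| / q) `^ r / 2).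
    by rewrite ler_expR -{1}(real_normK (num_real (a t))) lM.
  have e2 : (lambda * Num.min (a t ^+ 2) M) ^+ 2 <=
      lambda ^+ 2 * (q ^+ 4 * (384 * expR ((`|a t| / q) `^ r / 2))).
    rewrite exprMn ler_wpM2l ?sqr_ge0//.
    apply: (@le_trans _ _ ((a t ^+ 2) ^+ 2)); first by rewrite lerXn2r ?nnegrE// sqr_ge0.
    rewrite -exprM a4E ler_wpM2l ?exprn_ge0 ?(ltW q0)//.
    exact: quartic_le_expR_half_powR.
  have := ler_pM (sqr_ge0 _) (expR_ge0 _) e2 e1; move/le_trans; apply.
  rewrite [(`|a t| / q) `^ r in leRHS](splitr ((`|a t| / q) `^ r)) expRD.
  by rewrite le_eqVlt; apply/orP; left; apply/eqP; ring.
rewrite integral_lincomb//.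
- rewrite integral_affine//; last by move=> t; exact: sqr_ge0.
  rewrite (sp_variance aP) mule1.
  have c0' : (0 <= (384 * q ^+ 4 * lambda ^+ 2)%:E)%E by rewrite lee_fin.
  apply: le_trans (leeD2l _ (lee_wpmul2l c0' (sp_psi aP))) _.
  by rewrite -EFinM -!EFinD lee_fin; lra.
- by apply: measurable_funD => //; apply: measurable_funM.
- by move=> t; rewrite addr_ge0// mulr_ge0// sqr_ge0.
Qed.

End StandardPsi.
End Moments.

(** * Tail bounds for a random matrix *)

Section RandomMatrix.
Context d (T : measurableType d) (R : realType) (P : probability T R).
Context (n N : nat) (A : 'I_n -> 'I_N -> {RV P >-> R}) (q r : R).
Hypotheses (q1 : 1 <= q) (r1 : 1 <= r) (r2 : r <= 2).
Hypothesis indA : mutually_independent (fun ij : 'I_n * 'I_N => A ij.1 ij.2).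
Hypothesis psiA : forall i j, standard_psi P q r (A i j).

Notation family := (fun ij : 'I_n * 'I_N => A ij.1 ij.2).
Notation depends := (depends_on family).

Definition row_form (y : 'I_N -> R) (i : 'I_n) (s : seq 'I_N) (t : T) : R :=
  \sum_(j <- s) y j * A i j t.

Lemma depends_on_entry i j (J : {set 'I_n * 'I_N}) : (i, j) \in J ->
  depends J (A i j).
Proof. exact: (@depends_on_coordinate _ _ _ _ _ family). Qed.

Lemma depends_on_row_form y i s (J : {set 'I_n * 'I_N}) :
  {in s, forall j, (i, j) \in J} -> depends J (row_form y i s).
Proof.
elim: s => [|j s IH] sJ.
  have -> : row_form y i [::] = cst 0.
    by apply/funext => t; rewrite /row_form big_nil.
  exact: measurable_cst.
have -> : row_form y i (j :: s) = (cst (y j) \* A i j) \+ row_form y i s.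
  by apply/funext => t; rewrite /row_form big_cons.
apply: measurable_funD.
  by apply: measurable_funM => //; apply: depends_on_entry; apply: sJ; rewrite mem_head.
by apply: IH => k ks; apply: sJ; rewrite inE ks orbT.
Qed.

Lemma measurable_row_form y i s : measurable_fun [set: T] (row_form y i s).
Proof. by apply: measurable_sum => j; apply: measurable_funM. Qed.

Lemma independent_row_form_entry y i j s : j \notin s ->
  independent2 P (row_form y i s) (A i j).
Proof.
move=> js; apply: (depends_on_independent indA (J := [set ij | ij.2 \in s]%SET)
  (K := [set (i, j)]%SET)).
- apply/pred0P => -[k l] /=; rewrite !inE xpair_eqE.
  by apply/negbTE/negP => /andP[ls /andP[_ /eqP lj]]; rewrite -lj ls in js.
- by apply: depends_on_row_form => k ks; rewrite inE.
- by apply: depends_on_entry; rewrite inE.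
Qed.

Lemma row_form_second_moment y i s : uniq s ->
  (\int[P]_t (row_form y i s t ^+ 2)%:E = (\sum_(j <- s) y j ^+ 2)%:E)%E.
Proof.
elim: s => [_|j s IH /= /andP[js us]].
  rewrite /row_form big_nil; under eq_integral do rewrite big_nil expr0n.
  by rewrite integral_cst//= mul0e.
pose F (z : R * R) := (z.1 + y j * z.2) ^+ 2.
have mF : measurable_fun [set: R * R] F.
  by apply: measurable_funX; apply: measurable_funD => //; apply: measurable_funM.
have mS := measurable_row_form y i s.
transitivity (\int[P]_t (F (row_form y i s t, A i j t))%:E)%E.
  by apply: eq_integral => t _; rewrite /row_form big_cons addrC.
rewrite (independent2_tonelli mS _ (independent_row_form_entry y i js) mF)//; last first.
  by move=> z; exact: sqr_ge0.
transitivity (\int[P]_t (y j ^+ 2 + 1 * row_form y i s t ^+ 2)%:E)%E.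
  apply: eq_integral => t _; set x := row_form y i s t.
  transitivity (\int[P]_s (x ^+ 2 + (2 * x * y j) * A i j s
    + y j ^+ 2 * A i j s ^+ 2 + 0 * A i j s ^+ 4)%:E)%E.
    by apply: eq_integral => u _; congr EFin; rewrite /F /=; ring.
  by rewrite (integral_quartic_without_cubic q1 r1 r2 (psiA i j)) mul0e adde0 mul1r addrC.
rewrite integral_affine//.
- by rewrite IH// big_cons -EFinM -EFinD mul1r.
- exact: measurable_funX.
- by move=> t; exact: sqr_ge0.
- exact: sqr_ge0.
Qed.

(** Adding an independent centered term y a to S, one has
    E (S + y a)^4 <= E S^4 + 8 y^2 E S^2 + 3 y^4 E a^4, and 3 E a^4 <= 144 q^4;
    with B = 144 q^4 >= 4 this is at most B (E S^2 + y^2)^2. *)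
Lemma row_form_fourth_moment y i s : uniq s ->
  (\int[P]_t (row_form y i s t ^+ 4)%:E <=
    (144 * q ^+ 4 * (\sum_(j <- s) y j ^+ 2) ^+ 2)%:E)%E.
Proof.
have q4 : 1 <= q ^+ 4 by rewrite exprn_ege1.
elim: s => [_|j s IH /= /andP[js us]].
  rewrite big_nil expr0n mulr0; under eq_integral do rewrite /row_form big_nil expr0n.
  by rewrite integral_cst//= mul0e.
have mS := measurable_row_form y i s.
have x4 (x : R) : 0 <= x ^+ 4 by rewrite (exprM _ 2 2) sqr_ge0.
have c8 : 0 <= 8 * y j ^+ 2 by apply: mulr_ge0 => //; exact: sqr_ge0.
have c3 : 0 <= 3 * y j ^+ 4 by apply: mulr_ge0.
(* The term in the cube of the entry, whose mean is unknown, is absorbed by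
   its neighbours of even degree. *)
pose G (z : R * R) := z.1 ^+ 4 + (4 * z.1 ^+ 3 * y j) * z.2
    + (8 * z.1 ^+ 2 * y j ^+ 2) * z.2 ^+ 2 + (3 * y j ^+ 4) * z.2 ^+ 4.
have mG : measurable_fun [set: R * R] G.
  have m1 k : measurable_fun [set: R * R] (fun z : R * R => z.1 ^+ k).
    by apply: measurable_funX.
  have m2 k : measurable_fun [set: R * R] (fun z : R * R => z.2 ^+ k).
    by apply: measurable_funX.
  by apply: measurable_funD; [apply: measurable_funD; [apply: measurable_funD|]|];
    do ?[apply: measurable_funM => //].
have FG z : (z.1 + y j * z.2) ^+ 4 <= G z.
  rewrite -subr_ge0.
  have -> : G z - (z.1 + y j * z.2) ^+ 4 =
    2 * (y j * z.2 * (z.1 - y j * z.2)) ^+ 2 by rewrite /G; ring.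
  by apply: mulr_ge0 => //; exact: sqr_ge0.
have G0 z : 0 <= G z by apply: le_trans (FG z).
have mpow k : measurable_fun [set: T] (fun t => row_form y i s t ^+ k).
  exact: measurable_funX.
apply: (@le_trans _ _ (\int[P]_t (G (row_form y i s t, A i j t))%:E)%E).
  apply: integral_mono => //.
  - by apply: measurable_funX; exact: measurable_row_form.
  - by apply: (measurableT_comp mG); exact: measurable_fun_pair.
  - by move=> t; apply: le_trans (FG _); rewrite /row_form big_cons addrC.
rewrite (independent2_tonelli mS _ (independent_row_form_entry y i js) mG)//.
have m4 := fourth_moment q1 r1 r2 (psiA i j).
set c := (\int[P]_s (A i j s ^+ 4)%:E)%E in m4.
have c0 : (0 <= c)%E by apply: integral_ge0 => t _; rewrite lee_fin.
have cE : c = (fine c)%:E.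
  by rewrite fineK// ge0_fin_numE//; apply: le_lt_trans m4 _; rewrite ltry.
have fc0 : 0 <= fine c by exact: fine_ge0.
have {}m4 : fine c <= 48 * q ^+ 4 by rewrite -lee_fin -cE.
have -> : (\int[P]_t \int[P]_u (G (row_form y i s t, A i j u))%:E =
  \int[P]_t (3 * y j ^+ 4 * fine c + 1 *
    (row_form y i s t ^+ 4 + 8 * y j ^+ 2 * row_form y i s t ^+ 2))%:E)%E.
  apply: eq_integral => t _; rewrite /G /=.
  rewrite (integral_quartic_without_cubic q1 r1 r2 (psiA i j)) -/c cE -EFinM -EFinD /=.
  by congr EFin; ring.
rewrite integral_affine//; last 3 first.
- by apply: measurable_funD => //; apply: measurable_funM.
- by move=> t; rewrite addr_ge0// mulr_ge0// sqr_ge0.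
- exact: mulr_ge0.
rewrite integral_lincomb//; last by move=> t; exact: sqr_ge0.
rewrite row_form_second_moment// big_cons mul1e.
apply: le_trans (leeD2l _ (leeD2r _ (IH us))) _.
rewrite -EFinM -!EFinD lee_fin.
set z := \sum_(k <- s) _; have z0 : 0 <= z by apply: sumr_ge0 => k _; exact: sqr_ge0.
have c4 : 3 * y j ^+ 4 * fine c <= 3 * y j ^+ 4 * (48 * q ^+ 4) by exact: ler_wpM2l.
apply: le_trans (lerD c4 (lexx _)) _.
have -> : y j ^+ 4 = (y j ^+ 2) ^+ 2 by rewrite -exprM.
have := mulr_ge0 (sqr_ge0 (y j)) z0.
move: (y j ^+ 2) (q ^+ 4) q4 => w v v1 wz; have : w * z <= v * (w * z) by exact: ler_peMl.
nra.
Qed.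

Lemma measurable_superlevel (f : T -> R) (b : R) :
  measurable_fun [set: T] f -> measurable [set t | b <= f t].
Proof.
move=> mf; have -> : [set t | b <= f t] = f @^-1` `[b, +oo[%classic.
  by apply/seteqP; split=> t /=; rewrite in_itv /= andbT.
by rewrite -[X in measurable X]setTI; apply: mf.
Qed.

Lemma measurable_sublevel (f : T -> R) (b : R) :
  measurable_fun [set: T] f -> measurable [set t | f t < b].
Proof.
move=> mf; have -> : [set t | f t < b] = ~` [set t | b <= f t].
  by apply/seteqP; split=> t /=; rewrite ltNge => /negP.
by apply: measurableC; exact: measurable_superlevel.
Qed.

Lemma markov_bound (f : T -> R) (b : R) :
  measurable_fun [set: T] f -> (forall t, 0 <= f t) ->
  (P [set t | (expR b <= f t)%R] <= (expR (- b))%:E * \int[P]_t (f t)%:E)%E.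
Proof.
move=> mf f0; set E := [set t | _].
have mE : measurable E by exact: measurable_superlevel.
have <- : (\int[P]_t (\1_E t)%:E = P E)%E by rewrite integral_indic// setIT.
rewrite -ge0_integralZl//; last 2 first.
- exact/measurable_EFinP.
- by move=> t _; rewrite lee_fin.
under [leRHS]eq_integral do rewrite -EFinM.
apply: integral_mono => //.
- exact: measurable_funM.
move=> t; rewrite indicE; have [tE|tE] := boolP (t \in E); last first.
  by rewrite mulr_ge0// expR_ge0.
move: tE; rewrite inE /E /= => bf.
by rewrite -(expR0 R) -(addNr b) expRD ler_wpM2l// expR_ge0.
Qed.

Definition row_set (i : 'I_n) : {set 'I_n * 'I_N} := [set ij | ij.1 == i]%SET.

Lemma chernoff_rows (U : 'I_n -> T -> R) (a b : R) :
  (forall i, depends (row_set i) (U i)) -> (forall i t, 0 <= U i t) ->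
  (forall i, (\int[P]_t (U i t)%:E <= (expR a)%:E)%E) ->
  (P [set t | (expR b <= \prod_i U i t)%R] <= (expR (n%:R * a - b))%:E)%E.
Proof.
move=> dU U0 Ua.
have mU i : measurable_fun [set: T] (U i) by exact: depends_on_measurable (dU i).
apply: (le_trans (markov_bound b _ _)).
- by apply: measurable_prod => i _.
- by move=> t; apply: prodr_ge0.
rewrite (integral_prod_blocks indA (J := row_set))//; last 2 first.
- exact: index_enum_uniq.
- move=> i k ik; apply/pred0P => -[u v] /=; rewrite !inE /=.
  by apply/negbTE/negP => /andP[/eqP -> /eqP E]; rewrite E eqxx in ik.
have : (0 <= \prod_i \int[P]_t (U i t)%:E /\
    \prod_i \int[P]_t (U i t)%:E <= (\prod_(i < n) expR a)%:E)%E.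
  rewrite -prodEFin; elim/big_ind2: _ => // [x1 x2 y1 y2 [h1 h2] [h3 h4]|i _].
    by split; [exact: mule_ge0|exact: lee_pmul].
  by split=> //; apply: integral_ge0 => t _; rewrite lee_fin.
move=> [_].
rewrite prodr_const card_ord -expRM_natl => h.
have h0 : (0 <= (expR (- b))%:E)%E by rewrite lee_fin expR_ge0.
by apply: le_trans (lee_wpmul2l h0 h) _; rewrite -EFinM -expRD addrC.
Qed.

(** Each factor of the exponential moment is at most expR (2 * lambda), against
    a threshold of 3 * lambda per row. *)
Lemma truncated_column_bound (lambda : R) (j : 'I_N) :
  0 <= lambda -> 768 * q ^+ 4 * lambda <= 1 ->
  (forall x, 0 <= x -> lambda * Num.min (x ^+ 2) n%:R <= (x / q) `^ r / 2) ->
  (P [set t | (3 * n%:R <= \sum_i Num.min (A i j t ^+ 2) n%:R)%R]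
    <= (expR (- (lambda * n%:R)))%:E)%E.
Proof.
move=> l0 l1 lM.
pose U i t := expR (lambda * Num.min (A i j t ^+ 2) n%:R).
have mU i : measurable_fun [set: T] (U i).
  apply: measurableT_comp => //; apply: measurable_funM => //.
  by apply: measurable_minr => //; exact: measurable_funX.
have -> : - (lambda * n%:R) = n%:R * (2 * lambda) - 3 * lambda * n%:R by ring.
apply: (le_trans _ (chernoff_rows (U := U) (a := 2 * lambda) _ _ _ _)).
- apply: le_measure; rewrite ?inE.
  + apply: measurable_superlevel; apply: measurable_sum => i.
    by apply: measurable_minr => //; exact: measurable_funX.
  + by apply: measurable_superlevel; apply: measurable_prod => i _; exact: mU.
  move=> t /= h; rewrite /U -expR_sum ler_expR -mulr_sumr.
  by rewrite -mulrA mulrCA ler_wpM2l.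
- move=> i; apply: measurableT_comp => //; apply: measurable_funM => //.
  apply: measurable_minr => //; apply: measurable_funX.
  by apply: depends_on_entry; rewrite inE.
- by move=> i t; exact: expR_ge0.
- move=> i; apply: le_trans (truncated_mgf q1 r1 r2 (psiA i j) l0 _ lM) _ => //.
  rewrite lee_fin; apply: le_trans (expR_ge1Dx _).
  have : 768 * q ^+ 4 * lambda ^+ 2 <= lambda by rewrite expr2 mulrA ler_piMl.
  by lra.
Qed.

Lemma entry_tail (x : R) i j : 0 <= x ->
  (P [set t | (x <= `|A i j t|)%R] <= (2 * expR (- ((x / q) `^ r)))%:E)%E.
Proof.
move=> x0; have q0 : 0 < q by apply: lt_le_trans q1.
apply: (@le_trans _ _ (P [set t | (expR ((x / q) `^ r) <=
    expR ((`|A i j t| / q) `^ r))%R])).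
  apply: le_measure; rewrite ?inE.
  + by apply: measurable_superlevel; exact: measurableT_comp.
  + by apply: measurable_superlevel; exact: measurable_expR_psi.
  move=> t /= h; rewrite ler_expR; apply: ge0_ler_powR.
  - exact: le_trans r1.
  - by rewrite nnegrE divr_ge0// ltW.
  - by rewrite nnegrE divr_ge0// ltW.
  - by rewrite ler_wpM2r// invr_ge0 ltW.
apply: (le_trans (markov_bound _ _ _)).
- exact: measurable_expR_psi.
- by move=> t; exact: expR_ge0.
have h0 : (0 <= (expR (- ((x / q) `^ r)))%:E)%E by rewrite lee_fin expR_ge0.
by apply: le_trans (lee_wpmul2l h0 (sp_psi (psiA i j))) _; rewrite -EFinM mulrC.
Qed.

(** A sum of independent squares W_i^2 is rarely much smaller than its mean:
    E exp (- lambda W^2) <= 1 - lambda E W^2 + lambda^2 E W^4, where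
    E W^4 <= B s^2 for s = E W^2, and lambda = 1 / (4 B s) makes this at most
    exp (- 3 / (16 B)). *)
Lemma lattice_vector_lower_tail (y : 'I_N -> R) :
  (P [set t | (\sum_i (\sum_j A i j t * y j) ^+ 2 < n%:R / 2 * \sum_j y j ^+ 2)%R]
    <= (expR (- (n%:R / (2304 * q ^+ 4))))%:E)%E.
Proof.
set s := \sum_j y j ^+ 2.
have s0 : 0 <= s by apply: sumr_ge0 => j _; exact: sqr_ge0.
have [sE|sN] := eqVneq s 0.
  rewrite sE mulr0 [X in P X](_ : _ = set0).
    by rewrite measure0 lee_fin expR_ge0.
  apply/seteqP; split=> // t /=; rewrite ltNge => /negP; apply.
  by apply: sumr_ge0 => i _; exact: sqr_ge0.
have sp : 0 < s by rewrite lt0r sN.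
pose B : R := 144 * q ^+ 4.
have B0 : 0 < B by rewrite /B mulr_gt0// exprn_gt0// (lt_le_trans _ q1).
pose lambda := (4 * B * s)^-1.
have l0 : 0 < lambda.
  by rewrite invr_gt0; apply: mulr_gt0 => //; exact: mulr_gt0.
pose W i := row_form y i (index_enum 'I_N).
have WE i t : W i t = \sum_j A i j t * y j.
  by apply: eq_bigr => j _; rewrite mulrC.
pose U i t := expR (- (lambda * W i t ^+ 2)).
have mW i k : measurable_fun [set: T] (fun t => W i t ^+ k).
  by apply: measurable_funX; exact: measurable_row_form.
have mU i : measurable_fun [set: T] (U i).
  apply: measurableT_comp => //; apply: measurableT_comp => //.
  by apply: measurable_funM.
have ls : lambda * s = 1 / (4 * B) by rewrite /lambda; field; rewrite !gt_eqF.
have -> : - (n%:R / (2304 * q ^+ 4)) =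
    n%:R * (- (3 / (16 * B))) - (- (lambda * (n%:R / 2 * s))).
  rewrite [lambda * _]mulrCA ls /B; field.
  by rewrite gt_eqF// (lt_le_trans _ q1).
apply: (le_trans _ (chernoff_rows (U := U) (a := - (3 / (16 * B))) _ _ _ _)).
- apply: le_measure; rewrite ?inE.
  + apply: measurable_sublevel; apply: measurable_sum => i; apply: measurable_funX.
    by apply: measurable_sum => j; exact: measurable_funM.
  + by apply: measurable_superlevel; apply: measurable_prod => i _; exact: mU.
  move=> t /= h; rewrite /U -expR_sum ler_expR sumrN lerN2 -mulr_sumr.
  by rewrite ler_pM2l// ltW//; under eq_bigr do rewrite WE.
- move=> i; apply: measurableT_comp => //; apply: measurableT_comp => //.
  apply: measurable_funM => //; apply: measurable_funX.
  by apply: depends_on_row_form => j _; rewrite inE.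
- by move=> i t; exact: expR_ge0.
move=> i; have W4 := row_form_fourth_moment y i (index_enum_uniq 'I_N).
have W2 := row_form_second_moment y i (index_enum_uniq 'I_N).
have x4 (x : R) : 0 <= x ^+ 4 by rewrite (exprM _ 2 2) sqr_ge0.
have H : (\int[P]_t (U i t + lambda * W i t ^+ 2)%:E <=
          \int[P]_t (1 + lambda ^+ 2 * W i t ^+ 4)%:E)%E.
  apply: integral_mono.
  - by apply: measurable_funD => //; apply: measurable_funM.
  - by apply: measurable_funD => //; apply: measurable_funM.
  - by move=> t; apply: addr_ge0; [exact: expR_ge0|];
      apply: mulr_ge0; [exact: ltW|exact: sqr_ge0].
  move=> t; have := @expRN_le_1BxDsqr R (lambda * W i t ^+ 2).
  rewrite [(_ * _) ^+ 2]exprMn -exprM; apply.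
  by apply: mulr_ge0; [exact: ltW|exact: sqr_ge0].
move: H; rewrite integral_lincomb//; last 3 first.
- by move=> t; exact: expR_ge0.
- by move=> t; exact: sqr_ge0.
- exact: ltW.
rewrite integral_affine//; last exact: sqr_ge0.
rewrite W2 -/s -EFinM ls => H.
have l20 : (0 <= (lambda ^+ 2)%:E)%E by rewrite lee_fin sqr_ge0.
have {}H := le_trans H (leeD2l _ (lee_wpmul2l l20 W4)).
move: H; rewrite -/s -/B -EFinM -EFinD => H.
have -> : (\int[P]_t (U i t)%:E =
    \int[P]_t (U i t)%:E + (1 / (4 * B))%:E - (1 / (4 * B))%:E)%E.
  by rewrite addeK.
apply: le_trans (leeB H (lexx _)) _.
rewrite -EFinB lee_fin; apply: le_trans (expR_ge1Dx _).
have -> : lambda ^+ 2 * (B * s ^+ 2) = (lambda * s) ^+ 2 * B by ring.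
rewrite ls le_eqVlt; apply/orP; left; apply/eqP; field.
by rewrite gt_eqF.
Qed.


Lemma union_bound (I : eqType) (s : seq I) (B : I -> set T) (e : R) :
  (forall i, measurable (B i)) -> {in s, forall i, (P (B i) <= e%:E)%E} ->
  measurable [set t | exists2 i, i \in s & B i t] /\
  (P [set t | exists2 i, i \in s & B i t] <= ((size s)%:R * e)%:E)%E.
Proof.
move=> mB; elim: s => [|i s IH] Be.
  rewrite [X in measurable X](_ : _ = set0).
    by rewrite [X in P X](_ : _ = set0) ?measure0 ?mul0r//; apply/seteqP; split=> // t [].
  by apply/seteqP; split=> // t [].
have [|mS PS] := IH; first by move=> k ks; apply: Be; rewrite inE ks orbT.
have -> : [set t | exists2 k, k \in i :: s & B k t] =
    B i `|` [set t | exists2 k, k \in s & B k t].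
  apply/seteqP; split=> t.
    by move=> [k]; rewrite inE => /predU1P[->|ks] Bk; [left|right; exists k].
  move=> [Bi|[k ks Bk]]; first by exists i; rewrite ?mem_head.
  by exists k; rewrite // inE ks orbT.
split; first exact: measurableU.
apply: (@le_trans _ _ (P (B i) + P [set t | exists2 k, k \in s & B k t])%E).
  exact: measureU2.
apply: (le_trans (leeD (Be i (mem_head _ _)) PS)).
by rewrite -EFinD lee_fin /= -natr1 mulrDl mul1r addrC.
Qed.

Definition entries (t : T) : 'M[R]_(n, N) := \matrix_(i, j) A i j t.

(** The union bound runs over the multiplicity functions, which the counting
    lemma bounds with x = expR (- l). *)
Lemma lattice_event (s : nat) (l : R) : 1 <= l ->
  exists E : set T, [/\ measurable E,
    (P E <= (expR (s%:R * l + 4 * N%:R * expR (- l) - n%:R / (2304 * q ^+ 4)))%:E)%E &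
    forall t, ~ E t -> lower_isometry_on_lattice (entries t) s].
Proof.
move=> l1.
set F := [set f : {ffun ('I_N * bool) -> 'I_s.+1} | (\sum_k f k == s)%N]%SET.
pose y (f : {ffun ('I_N * bool) -> 'I_s.+1}) : 'I_N -> R :=
  lattice_vector R (fun k => f k : nat).
pose B (f : {ffun ('I_N * bool) -> 'I_s.+1}) := [set t |
  \sum_i (\sum_j A i j t * y f j) ^+ 2 < n%:R / 2 * \sum_j y f j ^+ 2].
have mB f : measurable (B f).
  apply: measurable_sublevel; apply: measurable_sum => i; apply: measurable_funX.
  by apply: measurable_sum => j; exact: measurable_funM.
have PB f : (P (B f) <= (expR (- (n%:R / (2304 * q ^+ 4))))%:E)%E.
  exact: lattice_vector_lower_tail.
have [mE PE] := union_bound (s := enum F) mB (fun f _ => PB f).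
exists [set t | exists2 f, f \in enum F & B f t]; split=> //.
- apply: le_trans PE _; rewrite lee_fin expRD ler_wpM2r ?expR_ge0//.
  have el : expR (- l) <= 1 / 2.
    rewrite expRN -(mul1r (_^-1)) ler_pdivrMr ?expR_gt0//.
    by have := expR_ge1Dx l; lra.
  have := card_compositions_le ('I_N * bool)%type s (expR_gt0 (- l)) el.
  rewrite -/F card_prod card_ord card_bool -cardE => h.
  rewrite expRD mulrC -ler_pdivrMr ?expR_gt0// -expRN.
  move: h; rewrite -expRM_natl mulrN natrM => h.
  by apply: le_trans h _; rewrite ler_expR; lra.
- move=> t nE f fs; rewrite leNgt; apply/negP => lt_f; apply: nE.
  have fle k : (f k < s.+1)%N by rewrite ltnS -fs (bigD1 k)//= leq_addr.
  pose g : {ffun ('I_N * bool) -> 'I_s.+1} := [ffun k => Ordinal (fle k)].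
  have gE : (fun k => g k : nat) = f by apply/funext => k; rewrite ffunE.
  exists g.
    rewrite mem_enum inE; apply/eqP; rewrite -[RHS]fs.
    by apply: eq_bigr => k _; rewrite ffunE.
  rewrite /B /= /y gE; move: lt_f.
  rewrite (eq_bigr (fun i => (\sum_j A i j t * lattice_vector R f j) ^+ 2))//.
  by move=> i _; congr (_ ^+ 2); apply: eq_bigr => j _; rewrite mxE.
Qed.

Lemma entries_event (x : R) : 0 <= x ->
  exists E : set T, [/\ measurable E,
    (P E <= ((n * N)%:R * (2 * expR (- ((x / q) `^ r))))%:E)%E &
    forall t, ~ E t -> forall i j, `|A i j t| < x].
Proof.
move=> x0; pose B (ij : 'I_n * 'I_N) := [set t | x <= `|A ij.1 ij.2 t|].
have mB ij : measurable (B ij).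
  by apply: measurable_superlevel; exact: measurableT_comp.
have PB ij : (P (B ij) <= (2 * expR (- ((x / q) `^ r)))%:E)%E by exact: entry_tail.
have [mE PE] := union_bound (s := enum {: 'I_n * 'I_N}) mB (fun f _ => PB f).
exists [set t | exists2 ij, ij \in enum {: 'I_n * 'I_N} & B ij t]; split=> //.
  by move: PE; rewrite -cardE card_prod !card_ord.
move=> t nE i j; rewrite ltNge; apply/negP => h; apply: nE.
by exists (i, j); rewrite ?mem_enum.
Qed.

Lemma columns_event (lambda : R) :
  0 <= lambda -> 768 * q ^+ 4 * lambda <= 1 ->
  (forall x, 0 <= x -> lambda * Num.min (x ^+ 2) n%:R <= (x / q) `^ r / 2) ->
  exists E : set T, [/\ measurable E,
    (P E <= (N%:R * expR (- (lambda * n%:R)))%:E)%E &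
    forall t, ~ E t -> forall j, \sum_i Num.min (A i j t ^+ 2) n%:R < 3 * n%:R].
Proof.
move=> l0 l1 lM.
pose B j := [set t | 3 * n%:R <= \sum_i Num.min (A i j t ^+ 2) n%:R].
have mB j : measurable (B j).
  apply: measurable_superlevel; apply: measurable_sum => i.
  by apply: measurable_minr => //; exact: measurable_funX.
have PB j : (P (B j) <= (expR (- (lambda * n%:R)))%:E)%E by exact: truncated_column_bound.
have [mE PE] := union_bound (s := enum 'I_N) mB (fun f _ => PB f).
exists [set t | exists2 j, j \in enum 'I_N & B j t]; split=> //.
  by move: PE; rewrite -cardE card_ord.
move=> t nE j; rewrite ltNge; apply/negP => h; apply: nE.
by exists j; rewrite ?mem_enum.
Qed.

Lemma null_space_event (m : nat) (l lambda : R) :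
  (0 < n)%N -> (0 < m)%N -> 1 <= l ->
  0 <= lambda -> 768 * q ^+ 4 * lambda <= 1 ->
  (forall x, 0 <= x -> lambda * Num.min (x ^+ 2) n%:R <= (x / q) `^ r / 2) ->
  with_probability_at_least P
    (1 - (expR ((54 * m)%:R * l + 4 * N%:R * expR (- l) - n%:R / (2304 * q ^+ 4))
      + (n * N)%:R * (2 * expR (- ((Num.sqrt n%:R / q) `^ r)))
      + N%:R * expR (- (lambda * n%:R))))
    (fun t => null_space_property m (entries t)).
Proof.
move=> n0 m0 l1 l0 lq lM.
have [E1 [mE1 PE1 HE1]] := lattice_event (54 * m) l1.
have [E2 [mE2 PE2 HE2]] := entries_event (sqrtr_ge0 n%:R).
have [E3 [mE3 PE3 HE3]] := columns_event l0 lq lM.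
have mE : measurable (E1 `|` E2 `|` E3) by do 2 apply: measurableU => //.
exists (~` (E1 `|` E2 `|` E3)); split.
- exact: measurableC.
- move=> t /=; rewrite !not_orP => -[[nE1 nE2] nE3].
  apply: null_space_property_of_lattice => //; last exact: HE1.
  move=> j; apply: le_trans (ltW (HE3 t nE3 j)).
  apply: ler_sum => i _; rewrite mxE le_min lexx /=.
  have := ltW (HE2 t nE2 i j).
  rewrite -(@ler_sqr _ `|A i j t|) ?nnegrE ?sqrtr_ge0//.
  by rewrite sqr_sqrtr// real_normK// num_real.
- rewrite probability_setC// EFinB; apply: leeB => //; rewrite !EFinD.
  have mE12 : measurable (E1 `|` E2) by exact: measurableU.
  apply: (le_trans (measureU2 P mE12 mE3)); apply: leeD => //.
  by apply: (le_trans (measureU2 P mE1 mE2)); exact: leeD.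
Qed.

End RandomMatrix.

(** * Choice of the constants *)

Section Exponents.
Context (R : realType) (r psi : R).
Hypotheses (r1 : 1 <= r) (r2 : r <= 2) (psi2 : 1 / 2 <= psi).

Let psi0 : 0 < psi. Proof. by apply: lt_le_trans psi2; rewrite divr_gt0. Qed.
Let p0 : 0 <= r / 2.
Proof. by rewrite divr_ge0// (le_trans _ r1). Qed.
Let p1 : r / 2 <= 1. Proof. by rewrite ler_pdivrMr// mul1r. Qed.
Let psi_sqr : 1 <= 4 * psi ^+ 2.
Proof.
have : (1 / 2) ^+ 2 <= psi ^+ 2 by rewrite lerXn2r ?nnegrE ?divr_ge0 ?(ltW psi0).
by rewrite expr_div_n expr1n; lra.
Qed.

Lemma powR_ratio (x : R) : 0 <= x ->
  x `^ (r / 2) / psi `^ (2 * r) = (x / psi ^+ 4) `^ (r / 2).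
Proof.
move=> x0; have p40 : 0 < psi ^+ 4 by rewrite exprn_gt0.
have -> : psi `^ (2 * r) = (psi ^+ 4) `^ (r / 2).
  by rewrite -(powR_mulrn 4 (ltW psi0)) -powRrM; congr (_ `^ _); field.
have Y0 : (psi ^+ 4) `^ (r / 2) != 0 by rewrite gt_eqF// powR_gt0.
rewrite -[RHS](mulfK Y0); congr (_ / _); rewrite -powRM ?(ltW p40)//.
  by rewrite mulfVK// gt_eqF.
by rewrite divr_ge0// ltW.
Qed.

Lemma powR_sqr_half (u : R) : 0 <= u -> (u ^+ 2) `^ (r / 2) = u `^ r.
Proof.
by move=> u0; rewrite -(powR_mulrn 2 u0) -powRrM; congr (_ `^ _); field.
Qed.

Lemma psi_scale (y : R) : 0 <= y -> y / psi ^+ 4 <= 16 * (y / (2 * psi) ^+ 2).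
Proof.
move=> y0.
have -> : 16 * (y / (2 * psi) ^+ 2) = (4 * psi ^+ 2) * (y / psi ^+ 4).
  by field; rewrite gt_eqF.
by rewrite ler_peMl// divr_ge0// exprn_ge0// ltW.
Qed.

(** On [0, n] the linear function y / n is below the concave y |-> (y / n)^(r/2),
    which is the r-th power of sqrt (y / n). This turns the exponent
    lambda * y into a multiple of (|x| / psi) `^ r. *)
Lemma truncation_slope (n x : R) : 0 < n -> 0 <= x ->
  (n / psi ^+ 4) `^ (r / 2) / 32 / n * Num.min (x ^+ 2) n
    <= (x / (2 * psi)) `^ r / 2.
Proof.
move=> n0 x0; set y := Num.min _ _.
have y0 : 0 <= y by rewrite le_min sqr_ge0 ltW.
have yn : y <= n by rewrite ge_min lexx orbT.
have yx : y <= x ^+ 2 by rewrite ge_min lexx.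
have p40 : 0 < psi ^+ 4 by rewrite exprn_gt0.
have z0 : 0 <= y / n by rewrite divr_ge0// ltW.
have zp : y / n <= (y / n) `^ (r / 2).
  have [->|zN] := eqVneq (y / n) 0; first exact: powR_ge0.
  by apply: ger1_powR => //; rewrite lt0r zN z0/= ler_pdivrMr// mul1r.
have u0 : 0 <= x / (2 * psi) by rewrite divr_ge0// mulr_ge0// ltW.
have main : (n / psi ^+ 4) `^ (r / 2) * (y / n) <= 16 * (x / (2 * psi)) `^ r.
  apply: (le_trans (ler_wpM2l (powR_ge0 _ _) zp)).
  rewrite -powRM//; last by rewrite divr_ge0// ltW.
  have -> : n / psi ^+ 4 * (y / n) = y / psi ^+ 4 by field; rewrite !gt_eqF.
  have le1 : y / psi ^+ 4 <= 16 * (x / (2 * psi)) ^+ 2.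
    apply: (le_trans (psi_scale y0)); rewrite expr_div_n ler_wpM2l// ler_wpM2r//.
    by rewrite invr_ge0 sqr_ge0.
  apply: (@le_trans _ _ ((16 * (x / (2 * psi)) ^+ 2) `^ (r / 2))).
    apply: ge0_ler_powR => //; rewrite nnegrE; first by rewrite divr_ge0// ltW.
    by rewrite mulr_ge0// sqr_ge0.
  rewrite powRM ?sqr_ge0// powR_sqr_half// ler_wpM2r ?powR_ge0//.
  by apply: ler1_powR => //; rewrite ler1n.
have -> : (n / psi ^+ 4) `^ (r / 2) / 32 / n * y =
    (n / psi ^+ 4) `^ (r / 2) * (y / n) / 32 by field; rewrite gt_eqF.
by lra.
Qed.

Lemma entry_exponent (n : R) : 0 < n ->
  (n / psi ^+ 4) `^ (r / 2) / 16 <= (Num.sqrt n / (2 * psi)) `^ r.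
Proof.
move=> n0; have u0 : 0 <= Num.sqrt n / (2 * psi).
  by rewrite divr_ge0 ?sqrtr_ge0// mulr_ge0// ltW.
rewrite -powR_sqr_half// expr_div_n sqr_sqrtr ?(ltW n0)//.
rewrite ler_pdivrMr//.
apply: (@le_trans _ _ ((16 * (n / (2 * psi) ^+ 2)) `^ (r / 2))).
  apply: ge0_ler_powR => //; rewrite ?nnegrE.
  - by rewrite divr_ge0 ?exprn_ge0// ltW.
  - by rewrite mulr_ge0// divr_ge0 ?sqr_ge0// ltW.
  - by apply: psi_scale; exact: ltW.
rewrite powRM//; last by rewrite divr_ge0 ?sqr_ge0// ltW.
rewrite mulrC ler_wpM2l ?powR_ge0//.
by apply: ler1_powR => //; rewrite ler1n.
Qed.

End Exponents.

Lemma null_space_property_le (R : realType) (n N m k : nat) (A : 'M[R]_(n, N)) :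
  (m <= k)%N -> null_space_property k A -> null_space_property m A.
Proof. by move=> mk nspA h I Ah Im; apply: nspA Ah _; exact: leq_trans mk. Qed.

Lemma with_probability_at_least_le d (T : measurableType d) (R : realType)
    (P : probability T R) (a b : R) (Q1 Q2 : T -> Prop) :
  a <= b -> (forall t, Q1 t -> Q2 t) ->
  with_probability_at_least P b Q1 -> with_probability_at_least P a Q2.
Proof.
move=> ab Q12 [E [mE EQ PE]]; exists E; split=> //.
- by move=> t /EQ; exact: Q12.
- by apply: le_trans PE; rewrite lee_fin.
Qed.

(** The three terms are the failure probabilities for the lattice vectors, the
    truncation of the entries and the truncated columns. A bound on m >= 1
    forces D >= 1 / c, so that H = D^(r/2) <= D. *)
Lemma failure_probability (R : realType) (n N m : nat) (r psi : R)
    (C := 2 ^+ 24 : R) (c := C^-1) (D := n%:R / psi ^+ 4 : R) (H := D `^ (r / 2))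
    (L := ln (C * psi ^+ 6 * N%:R / n%:R)) :
  (0 < n)%N -> (n <= N)%N -> (0 < m)%N -> 1 <= r -> r <= 2 -> 1 / 2 <= psi ->
  N%:R <= expR (c * H) -> m%:R <= c * n%:R / (psi ^+ 4 * L `^ (2 / r)) ->
  [/\ 1 <= L, H <= D &
  expR ((54 * m)%:R * L + 4 * N%:R * expR (- L)
      - n%:R / (2304 * (2 * psi) ^+ 4))
    + (n * N)%:R * (2 * expR (- ((Num.sqrt n%:R / (2 * psi)) `^ r)))
    + N%:R * expR (- (H / 2 ^+ 14 / n%:R * n%:R)) <= C * expR (- (c * H))].
Proof.
move=> n0 nN m0 r1 r2 psi2 NH mle.
have psi0 : 0 < psi by apply: lt_le_trans psi2; rewrite divr_gt0.
have nR : 0 < n%:R :> R by rewrite ltr0n.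
have NR : 0 < N%:R :> R by rewrite ltr0n (leq_trans n0).
have m1 : 1 <= m%:R :> R by rewrite ler1n.
have CE : C = 64 * 64 * 64 * 64 by rewrite /C; ring.
have C0 : 0 < C by rewrite CE.
have cE : c = 1 / (64 * 64 * 64 * 64) by rewrite /c CE mul1r.
have psi6 : 1 / 64 <= psi ^+ 6.
  have : (1 / 2) ^+ 6 <= psi ^+ 6 by rewrite lerXn2r ?nnegrE ?divr_ge0 ?(ltW psi0).
  by rewrite expr_div_n expr1n; lra.
have psisq : 1 / 4 <= psi ^+ 2.
  have : (1 / 2) ^+ 2 <= psi ^+ 2 by rewrite lerXn2r ?nnegrE ?divr_ge0 ?(ltW psi0).
  by rewrite expr_div_n expr1n; lra.
have psi40 : 0 < psi ^+ 4 by rewrite exprn_gt0.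
pose K := C * psi ^+ 6 * N%:R / n%:R; have LE : L = ln K by [].
have Nn : 1 <= N%:R / n%:R :> R by rewrite ler_pdivlMr// mul1r ler_nat.
have K3 : 4 <= K.
  rewrite /K -mulrA; apply: le_trans (ler_pM _ _ (_ : 4 <= _) Nn) => //.
    by rewrite mulr1.
  by rewrite CE; lra.
have K0 : 0 < K by apply: lt_le_trans K3.
have L1 : 1 <= L.
  rewrite -ler_expR LE lnK ?posrE//; apply: le_trans K3.
  have -> : expR 1 = expR (1 / 2) ^+ 2 :> R.
    by rewrite -expRM_natl; congr expR; field.
  have h : expR (- (1 / 2)) * expR (1 / 2) = 1 :> R by rewrite -expRD addNr expR0.
  have := expR_ge1Dx (- (1 / 2) : R); have := expR_gt0 (1 / 2 : R).
  by move: (expR (- (1 / 2))) (expR (1 / 2)) h => a b ab b0 a0; nra.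
have L0 : 0 < L by apply: lt_le_trans L1.
have eL : expR (- L) = K^-1 by rewrite expRN LE lnK.
have DE : D * psi ^+ 4 = n%:R by rewrite /D mulfVK// gt_eqF.
have D0 : 0 < D by rewrite divr_gt0.
have mL : m%:R * L <= c * D.
  have Lr : L <= L `^ (2 / r).
    by apply: le1r_powR => //; rewrite ler_pdivlMr ?mul1r// (lt_le_trans _ r1).
  have Lr0 : 0 < L `^ (2 / r) by apply: lt_le_trans Lr.
  move: mle; rewrite ler_pdivlMr ?mulr_gt0// => mle.
  have : m%:R * L `^ (2 / r) <= c * D.
    by rewrite -(@ler_pM2r _ (psi ^+ 4))// -mulrA -[leRHS]mulrA DE [_ * psi ^+ 4]mulrC.
  by apply: le_trans; rewrite ler_wpM2l.
have D1 : 1 <= D.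
  have : 1 <= c * D by apply: le_trans mL; rewrite -[leLHS]mulr1 ler_pM.
  by rewrite cE; lra.
have p1 : r / 2 <= 1 by rewrite ler_pdivrMr// mul1r.
have HD : H <= D by apply: ler1_powR.
have H0 : 0 < H by exact: powR_gt0.
split=> //.
have e0 := expR_ge0 (- (c * H)).
have N0 : 0 <= N%:R :> R by exact: ltW.
(* The choice exp (- L) = n / (C psi^6 N) gives 4 N exp (- L) = 4 D / (C psi^2),
   a small multiple of D because psi >= 1/2. *)
have b1 : expR ((54 * m)%:R * L + 4 * N%:R * expR (- L)
      - n%:R / (2304 * (2 * psi) ^+ 4)) <= expR (- (c * H)).
  rewrite ler_expR natrM eL.
  have -> : n%:R / (2304 * (2 * psi) ^+ 4) = D / (36 * 32 * 32).
    by rewrite /D; field; rewrite gt_eqF.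
  have -> : 4 * N%:R / K = 4 * D / (C * psi ^+ 2).
    by rewrite /K /D; field; rewrite !gt_eqF.
  have b : 4 * D / (C * psi ^+ 2) <= 16 * D / C.
    rewrite ler_pdivrMr ?mulr_gt0 ?exprn_gt0//.
    have -> : 16 * D / C * (C * psi ^+ 2) = 16 * D * psi ^+ 2 by field; rewrite gt_eqF.
    by nra.
  have : c * H <= c * D by rewrite ler_pM2l// cE.
  by move: mL b; rewrite cE CE; lra.
(* As n <= N, the union over all entries costs only exp (2 c H). *)
have b2 : (n * N)%:R * (2 * expR (- ((Num.sqrt n%:R / (2 * psi)) `^ r)))
    <= 2 * expR (- (c * H)).
  have e2 : (n * N)%:R <= expR (c * H) * expR (c * H).
    by rewrite natrM; apply: ler_pM => //; apply: le_trans NH; rewrite ler_nat.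
  rewrite mulrCA ler_pM2l//.
  apply: (le_trans (ler_wpM2r (expR_ge0 _) e2)); rewrite -!expRD ler_expR.
  have := entry_exponent r1 r2 psi2 nR; rewrite -/D -/H.
  have : c * H <= H / 64 by rewrite cE; lra.
  by lra.
have b3 : N%:R * expR (- (H / 2 ^+ 14 / n%:R * n%:R)) <= expR (- (c * H)).
  rewrite mulfVK ?gt_eqF//.
  apply: (le_trans (ler_wpM2r (expR_ge0 _) NH)); rewrite -expRD ler_expR.
  have -> : H / 2 ^+ 14 = H / (64 * 256) by congr (_ / _); ring.
  by rewrite cE; lra.
apply: (le_trans (lerD (lerD b1 b2) b3)).
by rewrite CE; lra.
Qed.

Theorem theorem4p5 (R : realType) :
  exists C c : R, [/\ 0 < C, 0 < c &
  forall (n N : nat) (r psi : R)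
    (d : measure_display) (T : measurableType d) (P : probability T R)
    (A : 'I_n -> 'I_N -> {RV P >-> R}),
    (1 <= n)%N -> (n <= N)%N -> 1 <= r -> r <= 2 ->
    mutually_independent (fun ij : 'I_n * 'I_N => A ij.1 ij.2) ->
    (forall i j, ('E_P[A i j] = 0)%E) ->
    (forall i j, ('V_P[A i j] = 1)%E) ->
    (forall i j, (psi_norm P r (A i j) <= psi%:E)%E) ->
    N%:R <= expR (c * n%:R `^ (r / 2) / psi `^ (2 * r)) ->
    with_probability_at_least P
      (1 - C * expR (- (c * n%:R `^ (r / 2) / psi `^ (2 * r))))
      (fun t => forall m : nat, (1 <= m)%N -> (m <= n)%N ->
        m%:R <= c * n%:R /
          (psi ^+ 4 * ln (C * psi ^+ 6 * N%:R / n%:R) `^ (2 / r)) ->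
        let At : 'M[R]_(n, N) := \matrix_(i, j) A i j t in
        neighborly m (Kplus At) /\ centrally_neighborly m (Kpm At))].
Proof.
(* The largest constant to beat is 2304 * 2 ^+ 4 from the lattice vectors,
   together with the factor 54 in the number of summands. *)
exists (2 ^+ 24), (2 ^+ 24)^-1; split=> //.
move=> n N r psi d T P A n0 nN r1 r2 indA EA VA psiA.
have [psi2 _] := standard_psi_of_norm r1 r2 (EA (Ordinal n0) (Ordinal (leq_trans n0 nN)))
  (VA _ _) (psiA _ _).
have stdA i j : standard_psi P (2 * psi) r (A i j).
  by have [] := standard_psi_of_norm r1 r2 (EA i j) (VA i j) (psiA i j).
rewrite -mulrA powR_ratio//.
set H := (_ / psi ^+ 4) `^ _ => NH.
set bound := (_ / (psi ^+ 4 * _)).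
pose ok m := [&& (0 < m)%N, (m <= n)%N & m%:R <= bound].
have [[m0 okm0]|none] := pselect (exists m, ok m); last first.
  exists setT; split=> //.
    by move=> t _ m m1 mn mb; exfalso; apply: none; exists m; apply/and3P.
  rewrite probability_setT lee_fin gerBl.
  by apply: mulr_ge0; [exact: exprn_ge0|exact: expR_ge0].
(* The largest admissible m takes care of all the others. *)
case: (@ex_maxnP ok n (ex_intro _ m0 okm0)) => [m /and3P[]//|m okm mmax].
have /and3P[m1 mn mb] := okm.
have [L1 HD fail] := failure_probability n0 nN m1 r1 r2 psi2 NH mb.
have nR : 0 < n%:R :> R by rewrite ltr0n.
have q1 : 1 <= 2 * psi by lra.
have H0 : 0 <= H by exact: powR_ge0.
have l0 : 0 <= H / 2 ^+ 14 / n%:R by rewrite !divr_ge0// exprn_ge0.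
have psi40 : 0 < psi ^+ 4 by rewrite exprn_gt0// (lt_le_trans _ psi2) ?divr_gt0.
have E14 : 2 ^+ 14 = 64 * 256 :> R by ring.
have lq : 768 * (2 * psi) ^+ 4 * (H / 2 ^+ 14 / n%:R) <= 1.
  have -> : 768 * (2 * psi) ^+ 4 * (H / 2 ^+ 14 / n%:R) =
      3 / 4 * (H * psi ^+ 4 / n%:R) by rewrite E14; field; rewrite gt_eqF.
  have : H * psi ^+ 4 / n%:R <= 1 by rewrite ler_pdivrMr// mul1r -ler_pdivlMr.
  by lra.
have lM x : 0 <= x ->
    H / 2 ^+ 14 / n%:R * Num.min (x ^+ 2) n%:R <= (x / (2 * psi)) `^ r / 2.
  move=> x0; apply: le_trans (truncation_slope r1 r2 psi2 nR x0).
  rewrite ler_wpM2r ?le_min ?sqr_ge0 ?ler0n// ler_wpM2r ?invr_ge0 ?ler0n//.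
  by rewrite -/H E14; lra.
have := null_space_event q1 r1 r2 indA stdA n0 m1 L1 l0 lq lM.
apply: with_probability_at_least_le; first by rewrite lerB.
move=> t nsp k k1 kn kb.
have km : (k <= m)%N by apply: mmax; apply/and3P.
have nspk := null_space_property_le km nsp.
split; first exact: null_space_property_neighborly nspk.
exact: null_space_property_centrally_neighborly nspk.
Qed.
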